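(* Let $Q$ be a pure $n$-dimensional lattice complex in $\mathbb{R}^n$. Then \[ \sum_{F}(n-1)!\, \mathrm{vol}_{n-1}'(F) = (-1)^{n-1}\sum_{k=0}^{n-1}(-1)^{k}\binom{n-1}{k} B(k\cdot \partial Q), \] where the left sum runs over the facets $F$ of $Q$, i.e. the $(n-1)$-dimensional cells of the boundary complex $\partial Q$.
   Context: A lattice complex is a bounded polyhedral complex all of whose vertices lie in $\mathbb{Z}^n$; it is pure $n$-dimensional if every maximal cell has dimension $n$. $\partial Q$ is the boundary complex of $Q$. For a polyhedral complex $R$ and integer $k\ge1$, $B(k\cdot R)$ is the number of integer points in the dilate $k\cdot|R|$ of the underlying set of $R$, and by convention $B(0\cdot R):=\chi(R)$, the Euler–Poincaré characteristic of $R$. For an $(n-1)$-dimensional lattice polytope $F$, $\mathrm{vol}'_{n-1}(F)$ is its $(n-1)$-dimensional volume normalized so that a fundamental domain of the lattice $\mathbb{Z}^n\cap L$ has volume 1, where $L$ is the linear hyperplane parallel to the affine hull of $F$. *)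

(* Defs.v *)
From HB Require Import structures.
From mathcomp Require Import all_boot all_order all_algebra.
From mathcomp Require Import all_classical all_reals all_analysis.
Set Implicit Arguments.
Unset Strict Implicit.
Unset Printing Implicit Defensive.
Import Order.TTheory GRing.Theory Num.Theory.
Local Open Scope classical_set_scope.
Local Open Scope ring_scope.

Section LatticeComplexes.
Variables (R : realType) (n : nat).
Local Notation V := 'rV[R]_n.

Definition dotv (a x : V) : R := \sum_(i < n) a ord0 i * x ord0 i.

Definition conv (S : seq V) : set V :=
  [set x | exists w : 'I_(size S) -> R,
     (forall i, 0 <= w i) /\ \sum_(i < size S) w i = 1 /\
     x = \sum_(i < size S) w i *: S`_(nat_of_ord i)].

Definition polytope (P : set V) : Prop :=
  exists S : seq V, S != [::] /\ P = conv S.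

(* nonempty face of a polytope: intersection with a supporting hyperplane
   (a = 0, b = 0 gives P itself) *)
Definition face (F P : set V) : Prop :=
  F !=set0 /\ exists (a : V) (b : R),
    (forall x, P x -> dotv a x <= b) /\ F = P `&` [set x | dotv a x = b].

Definition affind (P : set V) (d : nat) : Prop :=
  exists p : 'I_d.+1 -> V, (forall i, P (p i)) /\
    \rank (\matrix_(i < d) (p (lift ord0 i) - p ord0)) = d.

Definition dimc (P : set V) : nat := \max_(d < n.+1 | `[< affind P d >]) d.

Definition integral (x : V) : Prop := forall i, x ord0 i \is a Num.int.

Definition polyhedral_complex (C : set (set V)) : Prop :=
  [/\ finite_set C,
      (forall P, C P -> polytope P),
      (forall P F, C P -> face F P -> C F) &
      (forall P Q, C P -> C Q -> P `&` Q !=set0 ->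
         face (P `&` Q) P /\ face (P `&` Q) Q)].

Definition lattice_complex (C : set (set V)) : Prop :=
  polyhedral_complex C /\
  (forall P, C P -> dimc P = 0%N -> forall x, P x -> integral x).

Definition maximal_cell (C : set (set V)) (P : set V) : Prop :=
  C P /\ forall Q, C Q -> P `<=` Q -> Q = P.

Definition pure (C : set (set V)) (d : nat) : Prop :=
  forall P, maximal_cell C P -> dimc P = d.

Definition facets (C : set (set V)) : set (set V) :=
  [set F | C F /\ dimc F = n.-1 /\
     exists P, [/\ C P, dimc P = n, F `<=` P &
       forall P', C P' -> dimc P' = n -> F `<=` P' -> P' = P]].

Definition boundary (C : set (set V)) : set (set V) :=
  [set G | exists F, facets C F /\ face G F].

Definition support (C : set (set V)) : set V := [set x | exists P, C P /\ P x].

Definition euler_char (C : set (set V)) : R := \sum_(P \in C) (-1 : R) ^+ dimc P.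

Definition Bcount (k : nat) (C : set (set V)) : R :=
  if k == 0%N then euler_char C
  else \sum_(z \in [set z : 'rV[int]_n |
                    support C (k%:R^-1 *: map_mx (fun m : int => (m%:~R : R)) z)]) (1 : R).

End LatticeComplexes.

(* d-dimensional Lebesgue measure on 'rV[R]_d, by iterated integration of
   the indicator (Tonelli) *)
Fixpoint lvol (R : realType) (d : nat) : set 'rV[R]_d -> \bar R :=
  match d with
  | 0 => fun S => if `[< S 0 >] then 1%E else 0%E
  | d'.+1 => fun S =>
      (\int[@lebesgue_measure R]_x
         lvol [set y : 'rV[R]_d' | S (row_mx (const_mx x : 'rV[R]_1) y)])%E
  end.

Section NormVol.
Variables (R : realType) (n : nat).
Local Notation V := 'rV[R]_n.

Definition parallel_space (F : set V) : set V :=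
  [set v | exists (m : nat) (c : 'I_m -> R) (x y : 'I_m -> V),
     (forall i, F (x i) /\ F (y i)) /\ v = \sum_(i < m) c i *: (x i - y i)].

Definition lattice_basis (L : set V) (d : nat) (B : 'M[R]_(d, n)) : Prop :=
  [/\ forall i, integral (row i B),
      forall i, L (row i B),
      \rank B = d &
      forall v, L v -> integral v ->
        exists c : 'rV[int]_d, v = map_mx (fun m : int => m%:~R) c *m B].

(* normalized (n-1)-volume of F: Lebesgue measure of F read in coordinates
   of a lattice basis of Z^n \cap L, based at a point of F *)
Definition normvol (F : set V) : R :=
  let B := xget 0 [set B : 'M[R]_(n.-1, n) | lattice_basis (parallel_space F) B] in
  let x0 := xget 0 F in
  fine (lvol [set y : 'rV[R]_(n.-1) | F (x0 + y *m B)]).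

End NormVol.

(* Main.v *)
Require Import Defs.
From HB Require Import structures.
From mathcomp Require Import all_boot all_order all_algebra.
From mathcomp Require Import all_classical all_reals all_analysis.
From mathcomp Require Import measurable_realfun.
From mathcomp Require Import ring lra zify.
Set Implicit Arguments.
Unset Strict Implicit.
Unset Printing Implicit Defensive.
Import Order.TTheory GRing.Theory Num.Theory.
Local Open Scope classical_set_scope.
Local Open Scope ring_scope.

(** The boundary is the disjoint union of the relative interiors of its cells,
    so it is enough to know the Ehrhart function of each relative interior.

    A cell is the convex hull of lattice points.  Choosing for every point the
    lexicographically least system of barycentric coordinates cuts the relative
    interior into open lattice simplices.  The lattice points in the dilates of
    an open d-simplex are counted by a polynomial of degree d with value (-1)^d
    at 0.  An additive Euler characteristic, defined by sweeping hyperplanes,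
    equals (-1)^dim on every bounded relatively open convex set; comparing it on
    the simplices and on their union shows that the polynomial of the relative
    interior of a cell P takes the value (-1)^dim P at 0.  Hence the function k
    |-> B(k . bd Q), including its conventional value at 0, is a polynomial of
    degree at most n-1, and the alternating sum extracts (n-1)! times its
    leading coefficient.

    Only facets contribute to that coefficient.  Read in coordinates of a
    lattice basis, unions of small grid cubes squeezed between two concentric
    dilates of a facet identify its contribution with the normalized volume. *)

(** Up to sign, the alternating sum is the (n-1)-st forward difference at 0. It reads the counting
    function exactly at 0, ..., n-1, so asymptotic counts would not suffice and the constant term
    must agree with the convention at 0. That constant term is the delicate point: the simplices are
    only shown to be disjoint and to cover, with no information on how their closures meet. Summing
    the signs (-1)^d over them calls for an invariant that is additive on indicator functions by
    construction. Lexicographic minimality makes the simplex through each point unique, which yields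
    disjointness without an induction over faces.

    The volume enters only through large dilates. [lvol] is an iterated integral of section volumes
    whose measurability is never established; what is available is monotonicity and the exact value
    on finite unions of half-open grid cubes, and the sandwich uses just these two facts. *)

Section Dot.
Variables (R : realType) (n : nat).
Implicit Types (a x y : 'rV[R]_n).

Lemma dotvE a x : dotv a x = (x *m a^T) ord0 ord0.
Proof. by rewrite mxE; apply: eq_bigr => i _; rewrite mxE mulrC. Qed.

Lemma dotvDr a x y : dotv a (x + y) = dotv a x + dotv a y.
Proof. by rewrite !dotvE mulmxDl mxE. Qed.

Lemma dotvZr a (c : R) x : dotv a (c *: x) = c * dotv a x.
Proof. by rewrite !dotvE -scalemxAl mxE. Qed.

Lemma dotvNr a x : dotv a (- x) = - dotv a x.
Proof. by rewrite -scaleN1r dotvZr mulN1r. Qed.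

Lemma dotvBr a x y : dotv a (x - y) = dotv a x - dotv a y.
Proof. by rewrite dotvDr dotvNr. Qed.

Lemma dotv_sumr a (I : Type) (r : seq I) (P : pred I) (F : I -> 'rV[R]_n) :
  dotv a (\sum_(i <- r | P i) F i) = \sum_(i <- r | P i) dotv a (F i).
Proof.
rewrite dotvE mulmx_suml summxE.
by apply: eq_bigr => i _; rewrite dotvE.
Qed.

Lemma dotvC a x : dotv a x = dotv x a.
Proof. by apply: eq_bigr => i _; rewrite mulrC. Qed.

Lemma dotv0l x : dotv 0 x = 0.
Proof. by rewrite /dotv big1 // => i _; rewrite mxE mul0r. Qed.

Lemma dotvDl a b x : dotv (a + b) x = dotv a x + dotv b x.
Proof. by rewrite !(dotvC _ x) dotvDr. Qed.

Lemma dotvZl (c : R) a x : dotv (c *: a) x = c * dotv a x.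
Proof. by rewrite !(dotvC _ x) dotvZr. Qed.

Lemma dotvNl a x : dotv (- a) x = - dotv a x.
Proof. by rewrite !(dotvC _ x) dotvNr. Qed.

Lemma dotvBl a b x : dotv (a - b) x = dotv a x - dotv b x.
Proof. by rewrite dotvDl dotvNl. Qed.

Lemma dotv_suml (I : Type) (r : seq I) (P : pred I) (F : I -> 'rV[R]_n) x :
  dotv (\sum_(i <- r | P i) F i) x = \sum_(i <- r | P i) dotv (F i) x.
Proof.
rewrite dotvC dotv_sumr.
by apply: eq_bigr => i _; rewrite dotvC.
Qed.

End Dot.

(** * Farkas' lemma *)

Section Farkas.
Variables (R : realType).

Definition cone n N (s : 'I_N -> 'rV[R]_n) : set 'rV[R]_n :=
  [set x | exists w : 'I_N -> R,
     (forall i, 0 <= w i) /\ x = \sum_(i < N) w i *: s i].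

(* Induction on the number of generators: if the functional a for the other
   generators is positive on the first one, project along it onto ker a. *)
Lemma farkas n N (s : 'I_N -> 'rV[R]_n) (b : 'rV[R]_n) :
  ~ cone s b -> exists a, (forall i, dotv a (s i) <= 0) /\ 0 < dotv a b.
Proof.
elim: N s b => [|N IHN] s b sb.
  exists b; split; first by case.
  have b0 : b != 0.
    apply/eqP => b0; apply: sb; exists (fun=> 0); split => //.
    by rewrite big_ord0.
  have [i bi] : exists i, b ord0 i != 0.
    apply/existsP; apply: contraR b0; rewrite negb_exists => /forallP b0.
    by apply/eqP/rowP => i; rewrite mxE; apply/eqP; rewrite -[_ == _]negbK b0.
  rewrite /dotv lt_neqAle sumr_ge0; last by move=> j _; rewrite -expr2 sqr_ge0.
  rewrite andbT eq_sym psumr_neq0; last by move=> j _; rewrite -expr2 sqr_ge0.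
  apply/hasP; exists i; first by rewrite mem_index_enum.
  by rewrite -expr2 /= lt_neqAle sqr_ge0 eq_sym sqrf_eq0 bi.
pose t := s ord0; pose s' i := s (lift ord0 i).
have [|a [as' ab]] := IHN s' b.
  move=> [w [w0 bE]]; apply: sb.
  exists (fun i => if unlift ord0 i is Some j then w j else 0); split.
    by move=> i; case: unlift => // j.
  rewrite big_ord_recl unlift_none scale0r add0r bE.
  by apply: eq_bigr => i _; rewrite liftK.
have [at0|at0] := leP (dotv a t) 0.
  exists a; split => // i; case: (unliftP ord0 i) => [j ->|-> //].
  exact: as'.
pose pr v := v - (dotv a v / dotv a t) *: t.
have [|a' [as'' ab']] := IHN (fun i => pr (s' i)) (pr b).
  move=> [w [w0 bE]]; apply: sb.
  exists (fun i => if unlift ord0 i is Some j then w j else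
    dotv a b / dotv a t + \sum_j w j * - (dotv a (s' j) / dotv a t)); split.
    move=> i; case: unlift => [j|]; first exact: w0.
    apply: addr_ge0; first by apply: divr_ge0; apply: ltW.
    apply: sumr_ge0 => j _; apply: mulr_ge0 => //.
    by rewrite -mulNr; apply: divr_ge0; rewrite ?oppr_ge0 ?as'//; apply: ltW.
  rewrite big_ord_recl unlift_none.
  transitivity (pr b + (dotv a b / dotv a t) *: t); first by rewrite subrK.
  rewrite bE addrC scalerDl -addrA; congr (_ + _).
  rewrite scaler_suml -big_split /=; apply: eq_bigr => i _.
  by rewrite liftK /pr scalerBr mulrN scaleNr scalerA addrC.
pose c := dotv a' t / dotv a t.
have E v : dotv (a' - c *: a) v = dotv a' (pr v).
  rewrite dotvBl dotvZl dotvBr dotvZr /c; field; exact: lt0r_neq0.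
exists (a' - c *: a); split; last by rewrite E.
move=> i; rewrite E; case: (unliftP ord0 i) => [j ->|->].
  exact: as''.
by rewrite /pr divff ?gt_eqF// scale1r subrr dotvE mul0mx mxE.
Qed.

End Farkas.

(** * Faces and relative interiors of polytopes *)

Section Convex.
Variables (R : realType) (n : nat).
Local Notation V := 'rV[R]_n.
Implicit Types (P F C : set V) (x y : V).

Definition cvx C := forall x y (t : R), C x -> C y -> 0 <= t <= 1 ->
  C ((1 - t) *: x + t *: y).

Definition hull N (s : 'I_N -> V) : set V :=
  [set x | exists w : 'I_N -> R,
     (forall i, 0 <= w i) /\ \sum_(i < N) w i = 1 /\
     x = \sum_(i < N) w i *: s i].

Definition relint P : set V :=
  [set x | P x /\ forall y, P y -> exists2 e : R, 0 < e & P (x + e *: (x - y))].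

Lemma hull_cvx N (s : 'I_N -> V) : cvx (hull s).
Proof.
move=> x y t [w [w0 [w1 ->]]] [v [v0 [v1 ->]]] /andP[t0 t1].
exists (fun i => (1 - t) * w i + t * v i); split.
  by move=> i; apply: addr_ge0; apply: mulr_ge0 => //; rewrite subr_ge0.
split; first by rewrite big_split /= -!mulr_sumr w1 v1 !mulr1 subrK.
rewrite !scaler_sumr -big_split /=; apply: eq_bigr => i _.
by rewrite !scalerA -scalerDl.
Qed.

Lemma hull_in N (s : 'I_N -> V) i : hull s (s i).
Proof.
exists (fun j => (j == i)%:R); split; first by move=> j; rewrite ler0n.
split; first by rewrite (bigD1 i) //= eqxx big1 ?addr0 // => j /negPf ->.
by rewrite (bigD1 i) //= eqxx scale1r big1 ?addr0 // => j /negPf ->; rewrite scale0r.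
Qed.

Lemma dotv_hull_le N (s : 'I_N -> V) a (b : R) :
  (forall i, dotv a (s i) <= b) -> forall x, hull s x -> dotv a x <= b.
Proof.
move=> sb x [w [w0 [w1 ->]]]; rewrite dotv_sumr.
rewrite -[b]mul1r -w1 mulr_suml; apply: ler_sum => i _.
by rewrite dotvZr ler_wpM2l.
Qed.

Lemma relint_sub P : relint P `<=` P.
Proof. by move=> x []. Qed.

Lemma relint_mid P y u (e : R) : cvx P -> P y -> relint P u -> 0 < e <= 1 ->
  relint P ((1 - e) *: y + e *: u).
Proof.
move=> cP Py [Pu ru] /andP[e0 e1]; split.
  by apply: cP => //; rewrite e1 ltW.
move=> z Pz; have [d d0 Pd] := ru z Pz.
have D0 : 0 < 1 + d * (1 - e).
  by rewrite ltr_wpDr // mulr_ge0 ?subr_ge0 // ltW.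
(* The target is where the segment from [y] to [u + d *: (u - z)] meets the ray from [z] through the
   given point; [e / (1 + d * (1 - e))] is its parameter on that segment. *)
exists (e * d / (1 + d * (1 - e))).
  by rewrite divr_gt0 // mulr_gt0.
have := cP _ _ (e / (1 + d * (1 - e))) Py Pd.
have -> : 0 <= e / (1 + d * (1 - e)) <= 1.
  rewrite (divr_ge0 (ltW e0) (ltW D0)) /= ler_pdivrMr // mul1r; apply: (le_trans e1).
  by rewrite lerDl (mulr_ge0 (ltW d0)) ?subr_ge0.
move=> /(_ isT); congr P; apply/rowP => i; rewrite !mxE; field.
exact: lt0r_neq0.
Qed.

Lemma relint_cvx P : cvx P -> cvx (relint P).
Proof.
move=> cP x y t rx ry /andP[t0 t1].
have [->|t_neq0] := eqVneq t 0; first by rewrite subr0 scale1r scale0r addr0.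
apply: relint_mid => //; first exact: relint_sub rx.
by rewrite t1 lt_neqAle eq_sym t_neq0 t0.
Qed.

(** At the barycentre, a step of size 1/N away from a point with weights w_i leaves the weights 1/N
    + (1/N)(1/N - w_i), nonnegative because w_i <= 1. *)
Lemma relint_hull_nonempty N (s : 'I_N -> V) : (0 < N)%N ->
  relint (hull s) (N%:R^-1 *: \sum_i s i).
Proof.
move=> N0; have NR : 0 < N%:R :> R by rewrite ltr0n.
split.
  exists (fun=> N%:R^-1); split; first by move=> i; rewrite invr_ge0 ltW.
  split; last by rewrite scaler_sumr.
  by rewrite sumr_const card_ord -[_ *+ _]mulr_natr mulVf ?lt0r_neq0.
move=> y [w [w0 [w1 ->]]]; exists N%:R^-1; first by rewrite invr_gt0.
exists (fun i => N%:R^-1 + N%:R^-1 * (N%:R^-1 - w i)); split.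
  move=> i; rewrite -[X in X + _]mulr1 -mulrDr; apply: mulr_ge0.
    by rewrite invr_ge0 ltW.
  rewrite addrCA addr_ge0 ?invr_ge0 ?(ltW NR) // subr_ge0 -w1.
  by rewrite (bigD1 i) //= lerDl sumr_ge0.
split.
  have NN : \sum_(i < N) (N%:R^-1 : R) = 1.
    by rewrite sumr_const card_ord -[_ *+ _]mulr_natr mulVf ?lt0r_neq0.
  by rewrite big_split /= -mulr_sumr big_split /= sumrN NN w1 subrr mulr0 addr0.
rewrite scaler_sumr -sumrB scaler_sumr -big_split /=; apply: eq_bigr => i _.
by rewrite scalerDl -scalerA; congr (_ + _ *: _); rewrite scalerBl.
Qed.

(** Scaling conical weights of total C by 1/(1+C) leaves weight 1/(1+C) for [x] itself, so a conical
    combination of the directions [s i - x] becomes a convex one. This reduces prolongation to cone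
    membership, where Farkas applies. *)
Lemma hull_extend N (s : 'I_N -> V) x y : hull s x ->
  cone (fun i => s i - x) (x - y) ->
  exists2 e : R, 0 < e & hull s (x + e *: (x - y)).
Proof.
move=> [w [w0 [w1 xE]]] [c [c0 ->]].
pose C := \sum_i c i; have C0 : 0 <= C by apply: sumr_ge0.
have C1 : 0 < 1 + C by rewrite ltr_pwDl.
exists (1 + C)^-1; first by rewrite invr_gt0.
have CE : 1 - (1 + C)^-1 * C = (1 + C)^-1 by field; exact: lt0r_neq0.
exists (fun i => (1 - (1 + C)^-1 * C) * w i + (1 + C)^-1 * c i); split.
  move=> i; rewrite CE.
  by apply: addr_ge0; apply: mulr_ge0; rewrite ?invr_ge0 // ltW.
split.
  by rewrite big_split /= -!mulr_sumr w1 mulr1 -/C subrK.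
under [in RHS]eq_bigr do rewrite scalerDl -!scalerA.
rewrite big_split /= -!scaler_sumr -xE.
under eq_bigr do rewrite scalerBr.
rewrite big_split /= sumrN -scaler_suml -/C.
rewrite scalerBr scalerBl scale1r scalerA -!addrA; congr (_ + _).
by rewrite addrC.
Qed.

(* The face is cut out by the sum of all functionals that are maximal at x and
   detect some vertex; by Farkas no further vertex can be detected. *)
Lemma hull_face_relint N (s : 'I_N -> V) x : hull s x ->
  exists F, face F (hull s) /\ relint F x.
Proof.
move=> sx.
pose good i a := (forall j, dotv a (s j - x) <= 0) /\ dotv a (s i - x) < 0.
pose f i := xget 0 [set a | good i a].
have f0 i j : dotv (f i) (s j - x) <= 0.
  rewrite /f; case: xgetP => [a _ [] //|_].
  by rewrite dotv0l.
have fi i a : good i a -> dotv (f i) (s i - x) < 0.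
  by move=> ga; rewrite /f; case: xgetP => [b _ [] //|/(_ a)].
pose a := \sum_i f i.
have aj j : dotv a (s j) <= dotv a x.
  rewrite -subr_le0 -dotvBr dotv_suml; apply: sumr_le0 => i _; exact: f0.
exists (hull s `&` [set y | dotv a y = dotv a x]); split.
  split; first by exists x.
  by exists a, (dotv a x); split => // y; apply: dotv_hull_le.
split; first by [].
move=> y [sy ay].
suff /(hull_extend sx)[e e0 He] : cone (fun i => s i - x) (x - y).
  by exists e => //; split => //=; rewrite dotvDr dotvZr dotvBr ay subrr mulr0 addr0.
apply: contrapT => /farkas [b [bs bxy]].
have [w [w0 [w1 yE]]] := sy.
have {}yE : y - x = \sum_i w i *: (s i - x).
  under eq_bigr do rewrite scalerBr.
  by rewrite big_split /= sumrN -scaler_suml w1 scale1r -yE.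
have [i wi bi] : exists2 i, 0 < w i & dotv b (s i - x) < 0.
  apply: contrapT => H; move: bxy; rewrite ltNge => /negP; apply.
  rewrite -opprB dotvNr oppr_le0 yE dotv_sumr; apply: sumr_ge0 => i _.
  rewrite dotvZr; have [->|wi] := eqVneq (w i) 0; first by rewrite mul0r.
  rewrite mulr_ge0 // leNgt; apply/negP => bi; apply: H; exists i => //.
  by rewrite lt_neqAle eq_sym wi w0.
have : dotv a (y - x) < 0.
  rewrite yE dotv_sumr (bigD1 i) //=.
  rewrite -[X in _ < X]addr0.
  apply: ltr_leD.
    rewrite dotvZr pmulr_rlt0 // dotv_suml (bigD1 i) //=.
    rewrite -[X in _ < X]addr0.
    apply: ltr_leD; first exact: (fi _ b).
    by apply: sumr_le0 => j _; exact: f0.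
  apply: sumr_le0 => j _; rewrite dotvZr mulr_ge0_le0 //.
  by rewrite dotvBr subr_le0.
by rewrite dotvBr ay subrr ltxx.
Qed.

Lemma relint_face P F x : face F P -> relint P x -> F x -> F = P.
Proof.
move=> [_ [a [b [ab ->]]]] [Px rx] [_ /= ax].
apply/seteqP; split => y; first by case.
move=> Py; split => //=; apply/le_anti; rewrite ab //=.
have [e e0 /ab] := rx y Py.
by rewrite dotvDr dotvZr dotvBr ax gerDl pmulr_rle0 // subr_le0.
Qed.

(** Prepending a coordinate 1 to every point turns convex combinations into conical ones, so Farkas
    applies; the first coordinate of its functional is, up to sign, the offset [b]. *)
Lemma hull_separation N (s : 'I_N -> V) x : ~ hull s x ->
  exists a (b : R), (forall i, dotv a (s i) <= b) /\ b < dotv a x.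
Proof.
move=> sx; pose h (y : V) : 'rV[R]_(1 + n) := row_mx (const_mx 1) y.
have dh u y : dotv u (h y) = lsubmx u ord0 ord0 + dotv (rsubmx u) y.
  rewrite dotvC dotvE -[in LHS](hsubmxK u) tr_row_mx mul_row_col mxE.
  congr (_ + _); last by rewrite dotvC dotvE.
  by rewrite mxE big_ord1 [X in _ * X]mxE [X in _ * X]mxE mulr1.
have [|u [us ux]] := @farkas _ _ _ (fun i => h (s i)) (h x).
  move=> [w [w0 wE]]; apply: sx; exists w; split => //.
  have wE' : h x = row_mx (const_mx (\sum_i w i)) (\sum_i w i *: s i).
    rewrite wE; apply/rowP => j; rewrite summxE.
    case: (split_ordP j) => k ->; rewrite ?row_mxEl ?row_mxEr ?summxE ?mxE;
      apply: eq_bigr => i _; rewrite 1?mxE /h ?row_mxEl ?row_mxEr ?mxE ?mulr1 //.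
  have [w1 ->] := eq_row_mx wE'; split => //.
  by move: w1 => /rowP /(_ ord0); rewrite !mxE.
exists (rsubmx u), (- lsubmx u ord0 ord0); split; last first.
  by move: ux; rewrite dh; lra.
by move=> i; move: (us i); rewrite dh; lra.
Qed.

Lemma hull_vertices N (s : 'I_N -> V) (I : V -> Prop) :
  (forall x, face [set x] (hull s) -> I x) ->
  exists M (t : 'I_M -> V), hull s = hull t /\ forall i, I (t i).
Proof.
elim: N s => [|N IHN] s vI; first by exists 0%N, s; split => // -[].
have [H|/existsNP[i sI]] := pselect (forall i, I (s i)); first by exists N.+1, s.
have si : hull (fun j => s (lift i j)) (s i).
  apply: contrapT => /hull_separation[a [b [ab bx]]]; apply/sI/vI.
  have sle j : dotv a (s j) <= dotv a (s i).
    case: (unliftP i j) => [k ->|-> //].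
    by apply: le_trans (ltW bx); exact: ab.
  split; first by exists (s i).
  exists a, (dotv a (s i)); split; first exact: dotv_hull_le.
  apply/seteqP; split => y /=; first by move=> ->; split => //; exact: hull_in.
  move=> [[w [w0 [w1 ->]]]] ay.
  have wz k : w (lift i k) = 0.
    apply: contrapT => /eqP wk.
    have wk0 : 0 < w (lift i k) by rewrite lt_neqAle eq_sym wk w0.
    suff : dotv a (\sum_j w j *: s j) < dotv a (s i) by rewrite ay ltxx.
    rewrite dotv_sumr -[X in _ < X]mul1r -w1 mulr_suml.
    rewrite (bigD1 (lift i k)) //= [X in _ < X](bigD1 (lift i k)) //=.
    apply: ltr_leD.
      by rewrite dotvZr ltr_pM2l //; apply: le_lt_trans (ab k) bx.
    by apply: ler_sum => j _; rewrite dotvZr ler_wpM2l.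
  move: w1; rewrite (bigD1_ord i) //= big1 ?addr0 => [w1|j _]; last exact: wz.
  by rewrite (bigD1_ord i) //= big1 ?addr0 ?w1 ?scale1r // => j _; rewrite wz scale0r.
have E : hull s = hull (fun j => s (lift i j)).
  apply/seteqP; split => x [w [w0 [w1 ->]]]; last first.
    exists (fun j => if unlift i j is Some k then w k else 0); split.
      by move=> j; case: unlift.
    rewrite !(bigD1_ord i) //= unlift_none add0r scale0r add0r -w1.
    by split; apply: eq_bigr => j _; rewrite liftK.
  have [v [v0 [v1 siE]]] := si.
  exists (fun j => w i * v j + w (lift i j)); split.
    by move=> j; rewrite addr_ge0 ?mulr_ge0.
  split.
    by rewrite big_split /= -mulr_sumr v1 mulr1 -w1 [in RHS](bigD1_ord i).
  rewrite (bigD1_ord i) //= siE scaler_sumr -big_split /=.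
  by apply: eq_bigr => j _; rewrite scalerDl scalerA.
rewrite E; apply: IHN => x; rewrite -E; exact: vI.
Qed.

End Convex.

(** * Dimension, direction spaces and relative openness *)

Section Dimension.
Variables (R : realType) (n : nat).
Local Notation V := 'rV[R]_n.
Implicit Types (P F C : set V) (x y : V).

Lemma affind_bound P d : affind P d -> (d <= n)%N.
Proof. by move=> [p [_ <-]]; exact: rank_leq_col. Qed.

Lemma affind_dimc P d : affind P d -> (d <= dimc P)%N.
Proof.
move=> Pd; have dn : (d < n.+1)%N by rewrite ltnS; exact: affind_bound Pd.
rewrite /dimc; apply: (@leq_bigmax_cond _ (fun d : 'I_n.+1 => `[< affind P d >])
  (fun d => d : nat) (Ordinal dn)).
exact/asboolP.
Qed.

Lemma dimc_affind P x : P x -> affind P (dimc P).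
Proof.
move=> Px.
have P0 : affind P 0.
  exists (fun=> x); split => //; apply/eqP.
  by rewrite -leqn0; exact: rank_leq_row.
rewrite /dimc.
have [|d Pd ->] := @eq_bigmax_cond _ (fun d : 'I_n.+1 => `[< affind P d >])
  (fun d => d : nat).
  by apply/card_gt0P; exists ord0; apply/asboolP.
by have /asboolP := (Pd : `[< affind P d >]).
Qed.

Lemma dimc_mono P F x : F x -> F `<=` P -> (dimc F <= dimc P)%N.
Proof.
move=> Fx FP; apply: affind_dimc.
have [p [pF rp]] := dimc_affind Fx.
by exists p; split => // i; exact: FP.
Qed.

(** A difference outside the span would extend [p] to a longer affinely independent family, against
    the maximality in [dimc]. *)
Lemma affind_span P (p : 'I_(dimc P).+1 -> V) :
  (forall i, P (p i)) ->
  \rank (\matrix_(i < dimc P) (p (lift ord0 i) - p ord0)) = dimc P ->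
  forall x y, P x -> P y ->
    (x - y <= \matrix_(i < dimc P) (p (lift ord0 i) - p ord0))%MS.
Proof.
move=> pP; set D := \matrix_(i < _) _ => rD.
suff H x : P x -> (x - p ord0 <= D)%MS.
  move=> x y Px Py; rewrite -(subrKA (p ord0)) addmx_sub ?H//.
  by rewrite -opprB eqmx_opp H.
move=> Px; apply: contrapT => /negP xD.
pose q (i : 'I_(dimc P).+2) := if unlift ord_max i is Some j then p j else x.
suff : affind P (dimc P).+1 by move=> /affind_dimc; rewrite ltnn.
exists q; split; first by move=> i; rewrite /q; case: unlift.
set M := \matrix_(i < _) _.
have q0 : q ord0 = p ord0.
  rewrite /q; have -> : ord0 = lift ord_max (ord0 : 'I_(dimc P).+1).
    by apply/val_inj; rewrite /= /bump leqNgt ltn0Sn.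
  by rewrite liftK.
have DM : (D <= M)%MS.
  apply/row_subP => i; have -> : row i D = row (lift ord_max i) M.
    rewrite !rowK q0; congr (_ - _).
    have -> : lift ord0 (lift ord_max i) = lift ord_max (lift ord0 i).
      by apply/ord_inj; rewrite [RHS]lift_max /= /bump [(dimc P <= i)%N]leqNgt ltn_ord.
    by rewrite /q liftK.
  exact: row_sub.
have xM : (x - p ord0 <= M)%MS.
  have -> : x - p ord0 = row ord_max M.
    rewrite rowK q0; congr (_ - _).
    have -> : lift ord0 ord_max = ord_max :> 'I_(dimc P).+2 by apply/val_inj.
    by rewrite /q unlift_none.
  exact: row_sub.
apply/eqP; rewrite eqn_leq rank_leq_row /= -[X in (X < _)%N]rD.
apply: rank_ltmx; rewrite ltmxE DM.
by apply: contra xD; exact: submx_trans.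
Qed.

(* Relatively open convex sets, with the direction space given as the row space
   of U; unlike polytopes they are stable under hyperplane sections. *)
Definition roc C m (U : 'M[R]_(m, n)) :=
  [/\ cvx C, (forall x y, C x -> C y -> (x - y <= U)%MS) &
   forall x v, C x -> (v <= U)%MS -> exists2 e : R, 0 < e & C (x + e *: v)].

Lemma cvx_shrink P x v (e f : R) : cvx P -> P x -> P (x + e *: v) ->
  0 < f <= e -> P (x + f *: v).
Proof.
move=> cP Px Pe /andP[f0 fe].
have e0 : 0 < e by exact: lt_le_trans fe.
have := cP _ _ (f / e) Px Pe; rewrite divr_ge0 ?(ltW f0) ?(ltW e0) //=.
rewrite ler_pdivrMr // mul1r fe => /(_ isT); congr P.
by apply/rowP => i; rewrite !mxE; field; exact: lt0r_neq0.
Qed.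

(** The directions in which one can leave [u] inside P are closed under sums and nonnegative
    multiples, and contain both [y - u] and [u - y] for every [y] in P; hence they fill the whole
    direction space. *)
Lemma relint_roc P x : cvx P -> P x ->
  exists U : 'M[R]_(dimc P, n), [/\ \rank U = dimc P,
    forall x y, P x -> P y -> (x - y <= U)%MS & roc (relint P) U].
Proof.
move=> cP Px; have [p [pP rp]] := dimc_affind Px.
have U0 := affind_span pP rp.
set U := \matrix_(i < _) _ in rp U0; exists U; split => //.
split; first exact: relint_cvx.
  by move=> u v /relint_sub Pu /relint_sub Pv; exact: U0.
move=> u v ru vU; have [Pu _] := ru.
suff [e e0 Pe] : exists2 e : R, 0 < e & P (u + e *: v).
  exists (e / 2); first by rewrite divr_gt0.
  have half01 : 0 < (2^-1 : R) <= 1 by lra.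
  have := relint_mid cP Pe ru half01.
  congr (relint P _).
  by apply/rowP => i; rewrite !mxE; field.
have half01' : 0 <= (2^-1 : R) <= 1 by lra.
have add v1 v2 : (exists2 e : R, 0 < e & P (u + e *: v1)) ->
    (exists2 e : R, 0 < e & P (u + e *: v2)) ->
    exists2 e : R, 0 < e & P (u + e *: (v1 + v2)).
  move=> [e1 e10 P1] [e2 e20 P2].
  pose e := Num.min e1 e2; have e0 : 0 < e by rewrite lt_min e10.
  have Q1 : P (u + e *: v1).
    by apply: cvx_shrink cP Pu P1 _; rewrite e0 ge_min lexx.
  have Q2 : P (u + e *: v2).
    by apply: cvx_shrink cP Pu P2 _; rewrite e0 ge_min lexx orbT.
  exists (e / 2); first by rewrite divr_gt0.
  have := cP _ _ 2^-1 Q1 Q2.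
  move=> /(_ half01'); congr P.
  by apply/rowP => i; rewrite !mxE; field.
have scale c v1 : 0 <= c -> (exists2 e : R, 0 < e & P (u + e *: v1)) ->
    exists2 e : R, 0 < e & P (u + e *: (c *: v1)).
  move=> c0 [e e0 Pe]; have [->|c_neq0] := eqVneq c 0.
    by exists 1 => //; rewrite scale0r scaler0 addr0.
  exists (e / c); first by rewrite divr_gt0 // lt_neqAle eq_sym c_neq0.
  by rewrite scalerA divfK.
have pos y : P y -> exists2 e : R, 0 < e & P (u + e *: (y - u)).
  by move=> Py; exists 1 => //; rewrite scale1r addrC subrK.
have neg y : P y -> exists2 e : R, 0 < e & P (u + e *: (u - y)).
  by move=> Py; have [_ /(_ _ Py)] := ru.
have {vU}[c ->] := submxP vU; rewrite mulmx_sum_row.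
elim/big_ind: _ => //.
  by exists 1 => //; rewrite scaler0 addr0.
move=> i _; rewrite rowK.
have [c0|c0] := leP 0 (c 0 i).
  apply: scale => //.
  by rewrite -(subrKA u); apply: add; [exact: pos|exact: neg].
rewrite -[c 0 i]opprK scaleNr -scalerN opprB; apply: scale.
  by rewrite oppr_ge0 ltW.
by rewrite -(subrKA u); apply: add; [exact: pos|exact: neg].
Qed.

End Dimension.

(** * Open simplices and affine independence *)

Section Simplex.
Variables (R : realType) (n : nat).
Local Notation V := 'rV[R]_n.

Definition affree d (t : 'I_d.+1 -> V) := forall l : 'I_d.+1 -> R,
  \sum_i l i = 0 -> \sum_i l i *: t i = 0 -> forall i, l i = 0.

Definition osim d (t : 'I_d.+1 -> V) : set V :=
  [set x | exists w : 'I_d.+1 -> R,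
     [/\ forall i, 0 < w i, \sum_i w i = 1 & x = \sum_i w i *: t i]].

Definition simdir d (t : 'I_d.+1 -> V) : 'M[R]_(d, n) :=
  \matrix_(i < d) (t (lift ord0 i) - t ord0).

Lemma simdir_mul d (t : 'I_d.+1 -> V) (l : 'I_d.+1 -> R) : \sum_i l i = 0 ->
  (\row_i l (lift ord0 i)) *m simdir t = \sum_i l i *: t i.
Proof.
move=> l0; rewrite mulmx_sum_row [RHS]big_ord_recl.
have -> : l ord0 = - \sum_i l (lift ord0 i).
  by apply/eqP; rewrite -addr_eq0 -big_ord_recl l0.
rewrite scaleNr scaler_suml -sumrN -big_split /=; apply: eq_bigr => i _.
by rewrite rowK mxE scalerBr addrC.
Qed.

Lemma affree_rank d (t : 'I_d.+1 -> V) : affree t -> \rank (simdir t) = d.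
Proof.
move=> ft; apply/eqP; rewrite -[_ == _]/(row_free _) -kermx_eq0.
apply/eqP/row_matrixP => i; rewrite row0; set c := row i _.
have cU : c *m simdir t = 0 by apply/sub_kermxP; exact: row_sub.
pose l i := if unlift ord0 i is Some j then c 0 j else - \sum_j c 0 j.
have l0 : \sum_i l i = 0.
  rewrite big_ord_recl /l unlift_none addrC; apply/eqP; rewrite subr_eq0.
  by apply/eqP; apply: eq_bigr => j _; rewrite liftK.
have cE : c = \row_i l (lift ord0 i).
  by apply/rowP => j; rewrite [RHS]mxE /l liftK.
have := ft l l0; rewrite -(simdir_mul t l0) -cE => /(_ cU) H.
by rewrite cE; apply/rowP => j; rewrite !mxE H.
Qed.

Lemma pos_perturb N (w l : 'I_N -> R) : (forall i, 0 < w i) ->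
  exists2 e : R, 0 < e & forall i, 0 < w i + e * l i.
Proof.
move=> w0; have S0 : 0 <= \sum_j `|l j| / w j.
  by apply: sumr_ge0 => j _; rewrite divr_ge0 // ltW.
have S1 : 0 < 1 + \sum_j `|l j| / w j by rewrite ltr_pwDl.
exists (1 + \sum_j `|l j| / w j)^-1; first by rewrite invr_gt0.
move=> i; rewrite -(pmulr_rgt0 _ S1) mulrDr mulVKf ?lt0r_neq0 //.
rewrite -(pmulr_lgt0 _ (_ : 0 < (w i)^-1)) ?invr_gt0 // mulrDl.
rewrite mulfK ?lt0r_neq0 // -addrA ltr_pwDl //.
rewrite (bigD1 i) //= -addrA addrCA addr_ge0 //.
  by apply: sumr_ge0 => j _; rewrite divr_ge0 // ltW.
rewrite -mulrDl divr_ge0 ?(ltW (w0 i)) //.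
by have := ler_norm (- l i); rewrite normrN; lra.
Qed.

End Simplex.

(** * Lexicographic triangulation *)

Section Triangulation.
Variables (R : realType) (n : nat).
Local Notation V := 'rV[R]_n.

Lemma simplex_roc d (t : 'I_d.+1 -> V) : roc (osim t) (simdir t).
Proof.
split.
- move=> x y e [w [w0 w1 ->]] [v [v0 v1 ->]] /andP[e0 e1].
  exists (fun i => (1 - e) * w i + e * v i); split.
  + move=> i; have [->|e_neq0] := eqVneq e 0; first by rewrite subr0 mul1r mul0r addr0.
    rewrite ltr_wpDl ?mulr_gt0 ?mulr_ge0 ?subr_ge0 ?(ltW (w0 i)) //.
    by rewrite lt_neqAle eq_sym e_neq0 e0.
  + by rewrite big_split /= -!mulr_sumr w1 v1 !mulr1 subrK.
  + rewrite !scaler_sumr -big_split /=; apply: eq_bigr => i _.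
    by rewrite !scalerA -scalerDl.
- move=> x y [w [w0 w1 ->]] [v [v0 v1 ->]].
  have -> : \sum_i w i *: t i - \sum_i v i *: t i = \sum_i (w i - v i) *: t i.
    by rewrite -sumrB; apply: eq_bigr => i _; rewrite scalerBl.
  rewrite -simdir_mul ?submxMl //.
  by rewrite sumrB w1 v1 subrr.
- move=> x v [w [w0 w1 ->]] /submxP[c vE].
  pose l i := if unlift ord0 i is Some j then c 0 j else - \sum_j c 0 j.
  have l0 : \sum_i l i = 0.
    rewrite big_ord_recl /l unlift_none addrC; apply/eqP; rewrite subr_eq0.
    by apply/eqP; apply: eq_bigr => j _; rewrite liftK.
  have cE : c = \row_i l (lift ord0 i).
    by apply/rowP => j; rewrite [RHS]mxE /l liftK.
  have [e e0 we] := pos_perturb l w0.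
  exists e => //; exists (fun i => w i + e * l i); split => //.
    by rewrite big_split /= -mulr_sumr l0 mulr0 addr0.
  rewrite vE cE simdir_mul // scaler_sumr -big_split /=.
  by apply: eq_bigr => i _; rewrite scalerA -scalerDl.
Qed.

(** A short step from [y] away from [x] stays in the open simplex, so [y] lies strictly between a
    point of P and the relatively interior point [x]. One common point thus decides for the whole
    simplex. *)
Lemma osim_in_relint d (t : 'I_d.+1 -> V) P x : cvx P -> osim t `<=` P ->
  osim t x -> relint P x -> osim t `<=` relint P.
Proof.
move=> cP tP tx rx y ty; have [_ H1 H2] := simplex_roc t.
have [e e0 te] := H2 y (y - x) ty (H1 _ _ ty tx).
have E1 : 0 < 1 + e by rewrite ltr_pwDl // ltW.
have := relint_mid cP (tP _ te) rx (_ : 0 < e / (1 + e) <= 1).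
have H : 0 < e / (1 + e) <= 1.
  by rewrite divr_gt0 //= ler_pdivrMr // mul1r lerDr.
move=> /(_ H); congr (relint P _); apply/rowP => i; rewrite !mxE; field.
exact: lt0r_neq0.
Qed.

Section LexMin.
Variables (N : nat) (s : 'I_N -> V).
Implicit Types (w l : 'I_N -> R) (x : V) (T : {set 'I_N}).

Definition affker l := \sum_i l i = 0 /\ \sum_i l i *: s i = 0.

Definition neglex l := exists2 i, l i < 0 & forall j : 'I_N, (j < i)%N -> l j = 0.

(* T supports lexicographically minimal weights: no affine dependency that may
   be added to weights with support T makes them lexicographically smaller. *)
Definition lexgood T := forall l, affker l ->
  (forall i, i \notin T -> 0 <= l i) -> ~ neglex l.

Definition hullw w x :=
  [/\ forall i, 0 <= w i, \sum_i w i = 1 & x = \sum_i w i *: s i].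

Definition supp w : {set 'I_N} := [set i | w i != 0].

Definition indep T := forall l, affker l ->
  (forall i, i \notin T -> l i = 0) -> forall i, l i = 0.

Lemma affkerN l : affker l -> affker (fun i => - l i).
Proof.
move=> [l0 l1]; split; first by rewrite sumrN l0 oppr0.
by under eq_bigr do rewrite scaleNr; rewrite sumrN l1 oppr0.
Qed.

Lemma hullw_affker w v x : hullw w x -> hullw v x -> affker (fun i => w i - v i).
Proof.
move=> [w0 w1 wx] [v0 v1 vx]; split; first by rewrite sumrB w1 v1 subrr.
by under eq_bigr do rewrite scalerBl; rewrite sumrB -wx -vx subrr.
Qed.

Lemma neglex_total l : (forall i, l i = 0) \/ neglex l \/ neglex (fun i => - l i).
Proof.
have [H|/existsNP[i0 /eqP li0]] := pselect (forall i, l i = 0); first by left.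
right; case: (@arg_minnP _ i0 (fun i => l i != 0) (fun i => i)) => // i li imin.
have lj (j : 'I_N) : (j < i)%N -> l j = 0.
  by apply: contraTeq => /imin; rewrite leqNgt.
case: (ltrgt0P (l i)) => li0'; last by rewrite li0' eqxx in li.
  by right; exists i; [rewrite oppr_lt0|move=> j /lj ->; rewrite oppr0].
by left; exists i.
Qed.

Lemma neglexD l m : neglex l -> neglex m -> neglex (fun i => l i + m i).
Proof.
move=> [i li lz] [j mj mz]; case: (ltngtP i j) => ij.
- exists i; first by rewrite mz // addr0.
  by move=> k ki; rewrite lz // mz ?addr0 //; exact: ltn_trans ij.
- exists j; first by rewrite lz // add0r.
  by move=> k kj; rewrite mz // lz ?addr0 //; exact: ltn_trans ij.
- exists i; last by move=> k ki; rewrite lz // mz ?addr0 // -ij.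
  by move/val_inj: ij => ij; rewrite -[0]addr0 ltrD // ij.
Qed.

Lemma neglexZ (c : R) l : 0 < c -> neglex l -> neglex (fun i => c * l i).
Proof.
move=> c0 [i li lz]; exists i; first by rewrite pmulr_rlt0.
by move=> j /lz ->; rewrite mulr0.
Qed.

Lemma eq_neglex l m : l =1 m -> neglex l -> neglex m.
Proof. by move=> lm [i li lz]; exists i; [rewrite -lm|move=> j /lz; rewrite lm]. Qed.

Lemma lexgood_indep T : lexgood T -> indep T.
Proof.
move=> gT l kl lT; have [//|[H|H]] := neglex_total l; exfalso.
  by apply: (gT l kl) H => i /lT ->.
by apply: (gT _ (affkerN kl)) H => i /lT ->; rewrite oppr0.
Qed.

(** The difference [w - v] is an admissible move from [v], and its negative one from [w]; if
    nonzero, one of the two would be lexicographically negative. Disjointness of the simplices rests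
    on this. *)
Lemma lexgood_uniq w v x : hullw w x -> hullw v x ->
  lexgood (supp w) -> lexgood (supp v) -> w =1 v.
Proof.
move=> wx vx gw gv; have [w0 _ _] := wx; have [v0 _ _] := vx.
have [H|[H|H]] := neglex_total (fun i => w i - v i).
- by move=> i; apply/eqP; rewrite -subr_eq0 H.
- exfalso; apply: (gv _ (hullw_affker wx vx)) H => i.
  by rewrite inE negbK => /eqP ->; rewrite subr0.
- exfalso; apply: (gw _ (affkerN (hullw_affker wx vx))) H => i.
  by rewrite inE negbK => /eqP ->; rewrite sub0r opprK.
Qed.

(** The ratio test of the simplex method: the largest admissible step along [l] makes some positive
    weight vanish. *)
Lemma ratio w l : (forall i, 0 <= w i) -> (forall i, l i < 0 -> 0 < w i) ->
  (exists i, l i < 0) ->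
  exists t : R, [/\ 0 < t, forall i, 0 <= w i + t * l i &
    exists2 i, 0 < w i & w i + t * l i = 0].
Proof.
move=> w0 lw [i0 li0].
case: (@arg_minP _ _ _ i0 (fun i => l i < 0) (fun i => w i / - l i)) => // i li imin.
have ti : 0 < w i / - l i by rewrite divr_gt0 ?lw ?oppr_gt0.
exists (w i / - l i); split => //.
  move=> j; have [lj|lj] := ltP (l j) 0; last first.
    by rewrite addr_ge0 // mulr_ge0 // ltW.
  have := imin j lj; rewrite ler_pdivlMr ?oppr_gt0 // mulrN.
  by rewrite lerNl -subr_ge0 opprK addrC.
exists i; first exact: lw.
by rewrite invrN mulrN mulNr divfK ?subrr // lt_eqF.
Qed.

Lemma hullw_move w l x t : hullw w x -> affker l ->
  (forall i, 0 <= w i + t * l i) -> hullw (fun i => w i + t * l i) x.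
Proof.
move=> [w0 w1 wx] [l0 l1] H; split => //.
  by rewrite big_split /= -mulr_sumr w1 l0 mulr0 addr0.
under eq_bigr do rewrite scalerDl -scalerA.
by rewrite big_split /= -wx -scaler_sumr l1 scaler0 addr0.
Qed.

(** Caratheodory's reduction with an orientation: of a dependency and its negative, the
    lexicographically negative one is followed until a weight vanishes. The support shrinks, and the
    weights only decrease lexicographically. *)
Lemma hullw_reduce w x : hullw w x -> exists v,
  [/\ hullw v x, indep (supp v) & v =1 w \/ neglex (fun i => v i - w i)].
Proof.
move: {2}#|supp w|.+1 (ltnSn #|supp w|) => k; elim: k w => // k IHk w kw wx.
have [iw|niw] := pselect (indep (supp w)); first by exists w; split => //; left.
have [l [kl lw nl]] : exists l, [/\ affker l,
    forall i, i \notin supp w -> l i = 0 & neglex l].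
  move/existsNP: niw => [l /not_implyP[kl /not_implyP[lw nl]]].
  have [//|[H|H]] := neglex_total l; first by exists l.
  exists (fun i => - l i); split => //; first exact: affkerN.
  by move=> i /lw ->; rewrite oppr0.
have [w0 _ _] := wx.
have [||t [t0 tw [i wi wti]]] := @ratio w l w0.
- move=> i li; rewrite lt_neqAle w0 andbT eq_sym.
  have : i \in supp w by apply: contraTT li => /lw ->; rewrite ltxx.
  by rewrite inE.
- by have [i li _] := nl; exists i.
have vx := hullw_move wx kl tw.
have [|u [ux iu uw]] := IHk _ _ vx.
  rewrite -ltnS; apply: leq_trans kw; rewrite ltnS; apply: proper_card.
  apply/properP; split.
    apply/fintype.subsetP => j; rewrite !inE; apply: contraNN => /eqP wj.
    by rewrite wj lw ?mulr0 ?addr0 // inE wj eqxx.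
  by exists i; rewrite !inE ?wti ?eqxx // gt_eqF.
exists u; split => //; right.
have tl : neglex (fun i => t * l i) by exact: neglexZ.
case: uw => [uw|uw].
  by apply: eq_neglex tl => j; rewrite uw addrC addKr.
by apply: eq_neglex (neglexD uw tl) => j /=; rewrite opprD addrA subrK.
Qed.

Lemma exists_minimal (I : finType) (P : I -> Prop) (r : I -> I -> Prop) i0 :
  (forall i, ~ r i i) -> (forall i j k, r i j -> r j k -> r i k) -> P i0 ->
  exists i, P i /\ forall j, P j -> ~ r j i.
Proof.
move=> rxx rtr; pose m i := #|[pred j | `[< P j /\ r j i >]]|.
move: {2}(m i0).+1 (ltnSn (m i0)) => k; elim: k i0 => // k IHk i ki Pi.
have [H|/existsNP[j /not_implyP[Pj /contrapT rji]]] :=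
  pselect (forall j, P j -> ~ r j i); first by exists i.
apply: (IHk j) => //; rewrite -ltnS; apply: leq_trans ki; rewrite ltnS.
apply: proper_card; apply/properP; split.
  apply/fintype.subsetP => a /asboolP[Pa raj]; apply/asboolP.
  by split => //; exact: rtr raj rji.
by exists j; [exact/asboolP|apply/asboolP => -[_ /rxx]].
Qed.

(** To have a finite choice, the minimum is taken over affinely independent supports, each of which
    determines its weights. An improving move from the minimal system, followed by [hullw_reduce],
    would give a smaller one of the same kind. *)
Lemma lexgood_exists x : hull s x -> exists2 w, hullw w x & lexgood (supp w).
Proof.
move=> [w0 [w0p [w01 w0x]]].
have {w01 w0p w0x}w0x : hullw w0 x by split.
pose basic T w := [/\ hullw w x, indep T & supp w = T].
pose W T := xget (fun=> 0) [set w | basic T w].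
pose P T := basic T (W T).
have WP T w : basic T w -> P T by move=> bw; rewrite /P /W; case: xgetP => // /(_ w).
have Wu T w v : basic T w -> basic T v -> w =1 v.
  move=> [wx iT sw] [vx _ sv] i; apply/eqP; rewrite -subr_eq0; apply/eqP.
  apply: iT (hullw_affker wx vx) _ i => i iT.
  have : i \notin supp w by rewrite sw.
  have : i \notin supp v by rewrite sv.
  by rewrite !inE !negbK => /eqP -> /eqP ->; rewrite subrr.
have [v0 [v0x v0i _]] := hullw_reduce w0x.
have [|||T [PT Tmin]] := @exists_minimal _ P
  (fun T T' => neglex (fun i => W T i - W T' i)) (supp v0).
- by move=> T [i]; rewrite subrr ltxx.
- move=> T1 T2 T3 H1 H2; apply: eq_neglex (neglexD H1 H2) => i /=.
  by rewrite addrA subrK.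
- exact: (WP _ v0).
have [Wx iT sT] := PT; exists (W T) => // l kl lT nl.
have [Wp _ _] := Wx.
have [||t [t0 tw _]] := @ratio (W T) l Wp.
- move=> i li; rewrite lt_neqAle Wp andbT eq_sym.
  have : i \in supp (W T) by apply: contraTT li => /lT; rewrite -leNgt.
  by rewrite inE.
- by have [i li _] := nl; exists i.
have [u [ux iu uw]] := hullw_reduce (hullw_move Wx kl tw).
have bu : basic (supp u) u by [].
apply: (Tmin (supp u)); first exact: (WP _ u).
have uW := Wu _ _ _ bu (WP _ _ bu).
have tl : neglex (fun i => t * l i) by exact: neglexZ.
case: uw => [uw|uw].
  by apply: eq_neglex tl => j; rewrite -uW uw addrC addKr.
apply: eq_neglex (neglexD uw tl) => j /=.
by rewrite -uW opprD addrA subrK.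
Qed.

End LexMin.

(** A point of the hull lies in the open simplex on the support of its lexicographically least
    weights, and [lexgood_uniq] makes that support unique. Only simplices inside the relative
    interior are kept; by [osim_in_relint] they still cover it. *)
Lemma relint_hull_triangulation N (s : 'I_N -> V) :
  exists (TT : {set {set 'I_N}}) (d : {set 'I_N} -> nat)
         (t : forall T, 'I_(d T).+1 -> V),
  [/\ forall T, T \in TT -> affree (t T),
      forall T, T \in TT -> forall j, exists i, t T j = s i,
      forall T, T \in TT -> osim (t T) `<=` relint (hull s),
      forall x, relint (hull s) x -> exists2 T, T \in TT & osim (t T) x &
      forall x T T', T \in TT -> T' \in TT -> osim (t T) x -> osim (t T') x ->
        T = T'].
Proof.
have [N0|i0] : N = 0%N \/ exists i0 : 'I_N, True.
  by case: (N) => [|m]; [left|right; exists ord0].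
  move: s; rewrite N0 => s; exists finset.set0, (fun=> 0%N), (fun _ _ => 0).
  split; try by move=> T; rewrite inE.
    by move=> x [[w [_ []]]]; rewrite big_ord0 => /esym/eqP; rewrite oner_eq0.
  by move=> x T T'; rewrite inE.
have {i0}[i0 _] := i0.
(* For the empty set this degenerates to the single point [s i0], which is why [TT] excludes it. *)
pose d (T : {set 'I_N}) := #|T|.-1.
pose ix (T : {set 'I_N}) (j : nat) := nth i0 (enum T) j.
pose t (T : {set 'I_N}) (j : 'I_(d T).+1) := s (ix T j).
have dT (T : {set _}) : T != finset.set0 -> (d T).+1 = #|T|.
  by rewrite -card_gt0 => T0; rewrite prednK.
have sumT (M : nmodType) (T : {set _}) (F : 'I_N -> M) : T != finset.set0 ->
    \sum_(j < (d T).+1) F (ix T j) = \sum_(i in T) F i.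
  move=> T0; rewrite -[RHS]big_enum /= [RHS](big_nth i0) -cardE -dT //.
  by rewrite big_mkord.
have ixT (T : {set _}) (j : 'I_(d T).+1) : T != finset.set0 -> ix T j \in T.
  move=> T0; rewrite -mem_enum mem_nth // -cardE -dT //.
have ixK (T : {set _}) i : i \in T -> ix T (index i (enum T)) = i.
  by move=> iT; rewrite /ix nth_index // mem_enum.
have ixlt (T : {set _}) i : i \in T -> (index i (enum T) < (d T).+1)%N.
  move=> iT; rewrite dT; last by apply/set0Pn; exists i.
  by rewrite cardE index_mem mem_enum.
have ixinj (T : {set _}) (j k : 'I_(d T).+1) : T != finset.set0 -> ix T j = ix T k -> j = k.
  move=> T0 /eqP; rewrite /ix nth_uniq ?enum_uniq // -?cardE -?dT //.
  by move=> /eqP/val_inj.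
have osimP (T : {set _}) x : T != finset.set0 -> osim (t T) x <->
    exists2 w, hullw s w x & supp w = T.
  move=> T0; split => [[w [w0 w1 xE]]|[w [w0 w1 xE] sw]].
    pose v i := if i \in T then w (inord (index i (enum T))) else 0.
    have vE (j : 'I_(d T).+1) : v (ix T j) = w j :> R.
      rewrite /v ixT //; congr w; apply/(@ixinj T) => //.
      by rewrite inordK ?ixlt ?ixK ?ixT.
    have vT i : i \notin T -> v i = 0 by rewrite /v => /negPf ->.
    have vp i : i \in T -> 0 < v i by rewrite /v => ->.
    exists v.
      split.
      - by move=> i; case: (boolP (i \in T)) => [/vp/ltW|/vT ->].
      - rewrite -w1 -(eq_bigr _ (fun j _ => vE j)) sumT //.
        by rewrite [LHS](bigID (mem T)) /= [X in _ + X]big1 ?addr0 // => i /vT.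
      - rewrite xE -(eq_bigr _ (fun j _ => congr1 (fun c => c *: t T j) (vE j))).
        rewrite /t (sumT _ T (fun i => v i *: s i)) //.
        rewrite [RHS](bigID (mem T)) /= [X in _ + X]big1 ?addr0 // => i /vT ->.
        by rewrite scale0r.
    apply/setP => i; rewrite inE; case: (boolP (i \in T)) => [/vp/gt_eqF ->//|].
    by move=> /vT ->; rewrite eqxx.
  have swP i : (i \in T) = (w i != 0) by rewrite -sw inE.
  exists (fun j => w (ix T j)); split.
  - move=> j; rewrite lt_neqAle w0 andbT eq_sym.
    by rewrite -swP ixT.
  - rewrite sumT // -w1 [RHS](bigID (mem T)) /= [X in _ + X]big1 ?addr0 // => i.
    by rewrite swP negbK => /eqP.
  - rewrite /t (sumT _ T (fun i => w i *: s i)) // xE.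
    rewrite [LHS](bigID (mem T)) /= [X in _ + X]big1 ?addr0 // => i.
    by rewrite swP negbK => /eqP ->; rewrite scale0r.
pose TT : {set {set 'I_N}} := finset (fun T => (T != finset.set0) &&
  `[< lexgood s T /\ osim (t T) `<=` relint (hull s) >]).
have TTP T : T \in TT -> [/\ T != finset.set0, lexgood s T & osim (t T) `<=` relint (hull s)].
  by rewrite inE => /andP[T0 /asboolP[]].
exists TT, d, t; split.
- move=> T /TTP[T0 /lexgood_indep iT _] l l0 l1 j.
  pose m i := if i \in T then l (inord (index i (enum T))) else 0.
  have mE (k : 'I_(d T).+1) : m (ix T k) = l k :> R.
    rewrite /m ixT //; congr l; apply/(@ixinj T) => //.
    by rewrite inordK ?ixlt ?ixK ?ixT.
  have mT i : i \notin T -> m i = 0 by rewrite /m => /negPf ->.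
  rewrite -mE; apply: iT => //; split.
    rewrite -[RHS]l0 -[RHS](eq_bigr _ (fun j _ => mE j)) sumT //.
    by rewrite [LHS](bigID (mem T)) /= [X in _ + X]big1 ?addr0 // => i /mT.
  rewrite -[RHS]l1 -[RHS](eq_bigr _ (fun j _ => congr1 (fun c => c *: t T j) (mE j))).
  rewrite /t (sumT _ T (fun i => m i *: s i)) //.
  rewrite [LHS](bigID (mem T)) /= [X in _ + X]big1 ?addr0 // => i /mT ->.
  by rewrite scale0r.
- by move=> T _ j; exists (ix T j).
- by move=> T /TTP[].
- move=> x rx; have [w wx gw] := lexgood_exists (relint_sub rx).
  have s0 : supp w != finset.set0.
    apply/negP => /eqP sw; have [_ w1 _] := wx.
    have : \sum_i w i = 0.
      apply: big1 => i _; have : i \notin supp w by rewrite sw inE.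
      by rewrite inE negbK => /eqP.
    by rewrite w1 => /eqP; rewrite oner_eq0.
  have ox : osim (t (supp w)) x by apply/osimP => //; exists w.
  exists (supp w) => //; rewrite inE s0; apply/asboolP; split => //.
  apply: osim_in_relint ox rx; first exact: hull_cvx.
  by move=> y /(osimP _ _ s0)[v [v0 v1 vy] _]; exists v.
- move=> x T T' /TTP[T0 gT _] /TTP[T0' gT' _].
  move=> /(osimP _ _ T0)[w wx sw] /(osimP _ _ T0')[v vx sv].
  have wv : w =1 v by apply: lexgood_uniq wx vx _ _; rewrite ?sw ?sv.
  by rewrite -sw -sv; apply/setP => i; rewrite !inE wv.
Qed.

End Triangulation.

(** * Euler characteristic by sweeping *)

Section EulerSweep.
Variable R : realType.

(** The swept functions are piecewise constant, so a right limit is encoded as the constant value on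
    some interval to the right, without topology. *)
Definition rlim_spec (g : R -> R) (t v : R) :=
  exists2 e : R, 0 < e & forall u, t < u < t + e -> g u = v.

Definition rlim (g : R -> R) (t : R) : R := xget 0 [set v | rlim_spec g t v].

Definition tame1 (g : R -> R) :=
  finite_set [set t | g t != rlim g t] /\ forall t, exists v, rlim_spec g t v.

(** Integration against the Euler characteristic on the line, in Hadwiger's form. An open interval
    counts -1 through its left end, where the indicator is still 0 but its right limit is 1; a
    single point counts 1. *)
Definition chi1 (g : R -> R) : R := \sum_(t \in [set: R]) (g t - rlim g t).

Lemma rlim_uniq g t v w : rlim_spec g t v -> rlim_spec g t w -> v = w.
Proof.
move=> [e e0 gv] [f f0 gw]; pose h := Num.min e f.
have h0 : 0 < h by rewrite lt_min e0.
rewrite -(gv (t + h / 2)) ?(gw (t + h / 2)) //.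
  have : h <= f by rewrite ge_min lexx orbT.
  lra.
have : h <= e by rewrite ge_min lexx.
lra.
Qed.

Lemma rlimE g t v : rlim_spec g t v -> rlim g t = v.
Proof.
by move=> gv; rewrite /rlim; case: xgetP => [w _ gw|/(_ v)//]; exact: rlim_uniq gv.
Qed.

Lemma rlim_specD g h t v w : rlim_spec g t v -> rlim_spec h t w ->
  rlim_spec (fun t => g t + h t) t (v + w).
Proof.
move=> [e e0 gv] [f f0 gw]; exists (Num.min e f); first by rewrite lt_min e0.
have he : Num.min e f <= e by rewrite ge_min lexx.
have hf : Num.min e f <= f by rewrite ge_min lexx orbT.
by move=> u /andP[tu ut]; rewrite gv ?gw //; lra.
Qed.

Lemma chi1_fin g D : finite_set D -> [set t | g t != rlim g t] `<=` D ->
  chi1 g = \sum_(t \in D) (g t - rlim g t).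
Proof.
move=> fD gD; apply/esym/fsbig_widen => // t [_ nD] /=; apply/eqP.
by rewrite subr_eq0; apply: contra_notT nD => gt; exact: gD.
Qed.

Lemma tame1D g h : tame1 g -> tame1 h ->
  tame1 (fun t => g t + h t) /\ chi1 (fun t => g t + h t) = chi1 g + chi1 h.
Proof.
move=> [fg Lg] [fh Lh].
have E t : rlim (fun t => g t + h t) t = rlim g t + rlim h t.
  have [v gv] := Lg t; have [w hw] := Lh t.
  by rewrite (rlimE gv) (rlimE hw); apply/rlimE/rlim_specD.
pose D := [set t | g t != rlim g t] `|` [set t | h t != rlim h t].
have fD : finite_set D by rewrite finite_setU.
have sD : [set t | g t + h t != rlim (fun t => g t + h t) t] `<=` D.
  move=> t /= ght; have [gt|] := eqVneq (g t) (rlim g t); last by left.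
  by right; apply: contra ght => /eqP ht; rewrite E gt {1}ht.
split.
  split; first exact: sub_finite_set fD.
  move=> t; have [v gv] := Lg t; have [w hw] := Lh t.
  by exists (v + w); exact: rlim_specD.
rewrite (chi1_fin fD sD) (@chi1_fin g D) //; last by left.
rewrite (@chi1_fin h D) //; last by right.
rewrite -fsbig_split //; apply: eq_fsbigr => t _ /=.
by rewrite E opprD addrACA.
Qed.

Lemma chi1_const0 : tame1 (fun=> 0) /\ chi1 (fun=> 0) = 0.
Proof.
have E t : rlim (fun=> 0) t = 0 by apply: rlimE; exists 1.
split; last by rewrite /chi1 fsbig1 // => t _; rewrite E subr0.
split; last by move=> t; exists 0, 1.
by rewrite (_ : [set _ | _] = set0) // -subset0 => t /=; rewrite E eqxx.
Qed.

Lemma chi1_point (t0 c : R) (J : set R) : (forall t, J t <-> t = t0) ->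
  let g := fun t => if `[< J t >] then c else 0 in tame1 g /\ chi1 g = c.
Proof.
move=> JP g; have gE t : t != t0 -> g t = 0.
  by rewrite /g; case: asboolP => // /JP ->; rewrite eqxx.
have gt0 : g t0 = c by rewrite /g asboolT //; exact/JP.
have L t : rlim_spec g t 0.
  have [tt0|tt0] := ltP t t0.
    exists (t0 - t); first by rewrite subr_gt0.
    by move=> u ut; apply: gE; apply/eqP => u0; move: ut; rewrite u0; lra.
  exists 1 => // u ut; apply: gE; apply/eqP => u0; move: ut; rewrite u0; lra.
have E t := rlimE (L t).
have sD : [set t | g t != rlim g t] `<=` [set t0].
  by move=> t /=; rewrite E; apply: contra_neqP => /eqP; exact: gE.
split; first by split; [exact: sub_finite_set sD _|move=> t; exists 0].
by rewrite (chi1_fin _ sD) // fsbig_set1 E subr0.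
Qed.

Lemma chi1_itv (a b c : R) (J : set R) : a < b -> (forall t, J t <-> a < t < b) ->
  let g := fun t => if `[< J t >] then c else 0 in tame1 g /\ chi1 g = - c.
Proof.
move=> ab JP g; have gE t : ~~ (a < t < b) -> g t = 0.
  by rewrite /g; case: asboolP => // /JP ->.
have gc t : a < t < b -> g t = c by move=> /JP Jt; rewrite /g asboolT.
have L0 t : t < a -> rlim_spec g t 0.
  move=> ta; exists (a - t); first by rewrite subr_gt0.
  by move=> u ut; apply: gE; apply/negP; lra.
have Lb t : b <= t -> rlim_spec g t 0.
  by move=> bt; exists 1 => // u ut; apply: gE; apply/negP; lra.
have Lc t : a <= t -> t < b -> rlim_spec g t c.
  move=> ta tb; exists (b - t); first by rewrite subr_gt0.
  by move=> u ut; apply: gc; lra.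
have sD : [set t | g t != rlim g t] `<=` [set a].
  move=> t /=; have [ta|at_] := ltP t a.
    rewrite (rlimE (L0 t ta)) gE ?eqxx //; apply/negP; lra.
  have [tb|bt] := ltP t b; last first.
    rewrite (rlimE (Lb t bt)) gE ?eqxx //; apply/negP; lra.
  rewrite (rlimE (Lc t at_ tb)); apply: contra_neqP => /eqP nta.
  by rewrite gc // tb andbT lt_neqAle at_ andbT eq_sym.
split.
  split; first exact: sub_finite_set sD _.
  move=> t; have [ta|at_] := ltP t a; first by exists 0; exact: L0.
  by have [tb|bt] := ltP t b; [exists c; exact: Lc|exists 0; exact: Lb].
rewrite (chi1_fin _ sD) // fsbig_set1 (rlimE (Lc a _ _)) // gE ?sub0r //.
by rewrite ltxx.
Qed.

Definition slice n (phi : 'rV[R]_n.+1 -> R) (t : R) : 'rV[R]_n -> R :=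
  fun y => phi (row_mx (const_mx t : 'rV_1) y).

(* Sweeping the first coordinate: a section contributes by how much its Euler
   characteristic exceeds that of the sections immediately to its right. *)
Fixpoint Chi (n : nat) : ('rV[R]_n -> R) -> R :=
  match n with
  | 0 => fun phi => phi 0
  | n'.+1 => fun phi => chi1 (fun t => Chi (slice phi t))
  end.

Fixpoint tame (n : nat) : ('rV[R]_n -> R) -> Prop :=
  match n with
  | 0 => fun=> True
  | n'.+1 => fun phi => (forall t, tame (slice phi t)) /\
      tame1 (fun t => Chi (slice phi t))
  end.

Lemma tameD n (phi psi : 'rV[R]_n -> R) : tame phi -> tame psi ->
  tame (fun x => phi x + psi x) /\ Chi (fun x => phi x + psi x) = Chi phi + Chi psi.
Proof.
elim: n phi psi => [//|n IHn] phi psi /= [tphi t1] [tpsi t2].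
have H t := IHn _ _ (tphi t) (tpsi t).
have E : (fun t => Chi (slice (fun x => phi x + psi x) t)) =
    (fun t => Chi (slice phi t) + Chi (slice psi t)).
  by apply/funext => t; have [_] := H t.
rewrite E; have [T1 ->] := tame1D t1 t2; do !split => //.
by move=> t; have [] := H t.
Qed.

Lemma Chi0 n : tame (fun _ : 'rV[R]_n => 0 : R) /\ Chi (fun _ : 'rV[R]_n => 0) = 0.
Proof.
elim: n => [//|n [IH1 IH2]] /=.
have E : (fun t : R => Chi (slice (fun _ : 'rV[R]_n.+1 => 0 : R) t)) = (fun=> 0).
  by apply/funext => t; exact: IH2.
by rewrite E; have [T1 ->] := chi1_const0.
Qed.

Lemma Chi_sum n (I : Type) (r : seq I) (P : pred I) (phi : I -> 'rV[R]_n -> R) :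
  (forall i, P i -> tame (phi i)) ->
  Chi (fun x => \sum_(i <- r | P i) phi i x) = \sum_(i <- r | P i) Chi (phi i).
Proof.
move=> tphi; suff: tame (fun x => \sum_(i <- r | P i) phi i x) /\
  Chi (fun x => \sum_(i <- r | P i) phi i x) = \sum_(i <- r | P i) Chi (phi i).
  by case.
elim: r => [|i r [IH1 IH2]].
  under eq_fun do rewrite big_nil; rewrite big_nil; exact: Chi0.
under eq_fun do rewrite big_cons; rewrite big_cons; case: ifP => // Pi.
by rewrite -IH2; apply: tameD => //; exact: tphi.
Qed.

Definition ind n (C : set 'rV[R]_n) : 'rV[R]_n -> R :=
  fun x => if `[< C x >] then 1 else 0.

Definition bounded n (C : set 'rV[R]_n) :=
  exists M : R, forall x, C x -> forall i, `|x ord0 i| <= M.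

(** The projection J to the first coordinate is empty, a point or a bounded open interval. Every
    section is again relatively open with direction space [U'], so by induction the swept function
    is constant on J and 0 elsewhere; the sign gained in the interval case matches rank U = rank U'
    + 1. Empty sections cause no exception, since [roc] admits the empty set. *)
Lemma roc_Chi n (C : set 'rV[R]_n) m (U : 'M[R]_(m, n)) : roc C U -> bounded C ->
  tame (ind C) /\ Chi (ind C) = if `[< C !=set0 >] then (-1) ^+ \rank U else 0.
Proof.
elim: n C m U => [|n IHn] C m U rC [M CM].
  split=> //=; rewrite /ind; have -> : \rank U = 0%N.
    by apply/eqP; rewrite -leqn0; exact: rank_leq_col.
  congr (if `[< _ >] then _ else _); apply/propext; split; first by exists 0.
  by move=> [x]; rewrite (_ : x = 0) //; apply/rowP => -[].
pose Ct t : set 'rV[R]_n := [set y | C (row_mx (const_mx t : 'rV_1) y)].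
pose Pr : 'M[R]_(1 + n, 1) := col_mx 1%:M 0.
pose W : 'M[R]_(1 + n) := (U :&: kermx Pr)%MS.
pose Ul : 'M[R]_(m, 1) := lsubmx (U : 'M[R]_(m, 1 + n)).
have PrE k (A : 'M[R]_(k, 1 + n)) : A *m Pr = lsubmx A.
  by rewrite -[in LHS](hsubmxK A) mul_row_col mulmx1 mulmx0 addr0.
have W0 : lsubmx W = 0 by rewrite -PrE; apply/sub_kermxP; exact: capmxSr.
pose U' : 'M[R]_(1 + n, n) := rsubmx W.
have WE : W = row_mx 0 U' :> 'M[R]_(1 + n, 1 + n) by rewrite -W0 hsubmxK.
have rU : \rank U = (\rank Ul + \rank U')%N.
  rewrite -(mxrank_mul_ker U Pr) PrE; congr (_ + _)%N.
  by transitivity (\rank W) => //; rewrite WE rank_row_0mx.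
have U'P (v : 'rV[R]_n) : (v <= U')%MS <-> ((row_mx 0 v : 'rV[R]_(1 + n)) <= U)%MS.
  split => [/submxP[c ->]|vU].
    have -> : row_mx 0 (c *m U') = c *m W by rewrite WE mul_mx_row mulmx0.
    by apply: submx_trans (submxMl _ _) _; exact: capmxSl.
  have : ((row_mx 0 v : 'rV[R]_(1 + n)) <= W)%MS.
    rewrite sub_capmx vU /=; apply/sub_kermxP.
    by rewrite PrE row_mxKl.
  by move=> /submxP[c]; rewrite WE mul_mx_row mulmx0 => /eq_row_mx[_ ->]; exact: submxMl.
have {}CM : forall x : 'rV[R]_(1 + n), C x -> forall i : 'I_(1 + n), `|x ord0 i| <= M := CM.
have [cC dC oC] : @roc R (1 + n) C m U := rC.
have rCt t : roc (Ct t) U'.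
  split.
  - move=> x y e Cx Cy e01; rewrite /Ct /=.
    suff -> : row_mx (const_mx t : 'rV_1) ((1 - e) *: x + e *: y) =
        (1 - e) *: row_mx (const_mx t) x + e *: row_mx (const_mx t) y by exact: cC.
    rewrite !scale_row_mx add_row_mx; congr (row_mx _ _).
    by apply/rowP => i; rewrite !mxE; ring.
  - move=> x y Cx Cy; apply/U'P; have := dC _ _ Cx Cy.
    by rewrite opp_row_mx add_row_mx subrr.
  - move=> x v Cx /U'P vU; have [e e0] := oC _ _ Cx vU.
    by rewrite scale_row_mx add_row_mx scaler0 addr0 => Ce; exists e.
have bCt t : bounded (Ct t).
  by exists M => y Cy i; have := CM _ Cy (rshift 1 i); rewrite row_mxEr.
have HC t := IHn _ _ _ (rCt t) (bCt t).
pose J : set R := [set t | Ct t !=set0].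
pose r' : R := (-1) ^+ \rank U'.
have gE : (fun t => Chi (slice (ind C) t)) = (fun t => if `[< J t >] then r' else 0).
  by apply/funext => t; have [_] := HC t.
have sl (x : 'rV[R]_(1 + n)) : C x -> J (x ord0 (lshift n ord0)).
  move=> Cx; exists (rsubmx x); rewrite /Ct /=.
  suff <- : x = row_mx (const_mx (x ord0 (lshift n ord0)) : 'rV_1) (rsubmx x) by [].
  rewrite -[LHS]hsubmxK; congr (row_mx _ _).
  by apply/rowP => i; rewrite !mxE ord1.
rewrite [tame _]/= [Chi _]/= gE.
suff : tame1 (fun t => if `[< J t >] then r' else 0) /\
    chi1 (fun t => if `[< J t >] then r' else 0) =
      if `[< C !=set0 >] then (-1) ^+ \rank U else 0.
  by move=> [T1 T2]; split => //; split => // t; have [] := HC t.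
case: asboolP => [[x0 Cx0]|C0]; last first.
  have -> : (fun t => if `[< J t >] then r' else 0) = (fun=> 0).
    by apply/funext => t; case: asboolP => // -[y Cy]; exfalso; apply: C0; exists (row_mx (const_mx t : 'rV[R]_1) y).
  exact: chi1_const0.
have [U0|U0] := eqVneq Ul 0.
  rewrite rU U0 mxrank0 add0n.
  suff JP : forall t, J t <-> t = (x0 : 'rV[R]_(1 + n)) ord0 (lshift n ord0).
    exact: (chi1_point r' JP).
  move=> t; split => [[y Cy]|->]; last exact: sl.
  have /submxP[c cE] := dC _ _ Cy Cx0.
  have : (row_mx (const_mx t : 'rV[R]_1) y - x0) *m Pr = 0.
    by rewrite cE -mulmxA PrE -/Ul U0 mulmx0.
  rewrite PrE => /rowP/(_ ord0); rewrite [LHS]mxE [LHS]mxE [X in _ + X]mxE row_mxEl !mxE.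
  by move/eqP; rewrite subr_eq0 => /eqP.
have -> : \rank U = (\rank U').+1.
  rewrite rU; suff -> : \rank Ul = 1%N by [].
  by apply/eqP; rewrite eqn_leq rank_leq_col lt0n mxrank_eq0.
have [v vU v1] : exists2 v : 'rV[R]_(1 + n), (v <= U)%MS & v ord0 (lshift n ord0) = 1.
  have [i Ui] : exists i, Ul i ord0 != 0.
    apply/existsP; apply: contraNT U0; rewrite negb_exists => /forallP U0.
    apply/eqP/matrixP => i j; rewrite [RHS]mxE ord1; apply/eqP.
    by rewrite -[_ == _]negbK U0.
  exists ((Ul i ord0)^-1 *: row i U).
    by apply: scalemx_sub; exact: row_sub.
  by move: Ui; rewrite !mxE => Ui; rewrite mulVf.
have hD (x z : 'rV[R]_(1 + n)) j : (x + z) ord0 j = x ord0 j + z ord0 j.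
  by rewrite mxE.
have hZ c (x : 'rV[R]_(1 + n)) j : (c *: x) ord0 j = c * x ord0 j by rewrite mxE.
have hv t (y : 'rV[R]_n) :
    (row_mx (const_mx t : 'rV[R]_1) y) ord0 (lshift n ord0) = t.
  by rewrite row_mxEl mxE.
have oJ t : J t -> forall s, exists2 e : R, 0 < e & J (t + e * s).
  move=> [y Cy] s; have [|e e0 Ce] := oC _ (s *: v) Cy; first exact: scalemx_sub.
  by exists e => //; move: (sl _ Ce); rewrite hD !hZ hv v1 mulr1.
have cJ s t e : J s -> J t -> 0 <= e <= 1 -> J ((1 - e) * s + e * t).
  move=> [y Cy] [z Cz] e01; move: (sl _ (cC _ _ _ Cy Cz e01)).
  by rewrite hD !hZ !hv.
have bJ t : J t -> - M <= t <= M.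
  move=> [y Cy]; move: (CM _ Cy (lshift n ord0)); rewrite row_mxEl mxE.
  by rewrite ler_norml.
have J0 : J !=set0 by have := sl _ Cx0; exists ((x0 : 'rV[R]_(1 + n)) ord0 (lshift n ord0)).
have lJ : has_lbound J by exists (- M) => t /bJ /andP[].
have uJ : has_ubound J by exists M => t /bJ /andP[].
(* A nonempty bounded convex subset of the line that can be prolonged both ways at each of its
   points is the open interval between its bounds. *)
have JP t : J t <-> inf J < t < sup J.
  split => [Jt|/andP[it ts]].
    have [e e0 Je] := oJ t Jt (-1); have [f f0 Jf] := oJ t Jt 1.
    have := ge_inf lJ Je; have := ub_le_sup uJ Jf; lra.
  have [a Ja at_] := inf_lt J0 it; have [b Jb tb] := sup_gt J0 ts.
  have ab : 0 < b - a by rewrite subr_gt0 (lt_trans at_).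
  have := cJ a b ((t - a) / (b - a)) Ja Jb.
  rewrite divr_ge0 ?subr_ge0 ?(ltW at_) ?(ltW (lt_trans at_ tb)) //=.
  rewrite ler_pdivrMr // mul1r lerD2r (ltW tb) => /(_ isT).
  by congr J; field; exact: lt0r_neq0.
rewrite exprS mulN1r; suff ab : inf J < sup J by exact: (chi1_itv r' ab JP).
by have [t /JP/andP[]] := J0; exact: lt_trans.
Qed.

End EulerSweep.

(** * Counting integer points; polynomials in the binomial basis *)

Section Counting.
Variable R : realType.

Definition icount (T : choiceType) (A : set T) : R := \sum_(z \in A) (1 : R).

Lemma icount0 (T : choiceType) : icount (@set0 T) = 0.
Proof. by rewrite /icount fsbig_set0. Qed.

Lemma icount1 (T : choiceType) (x : T) : icount [set x] = 1.
Proof. by rewrite /icount fsbig_set1. Qed.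

Lemma icountU (T : choiceType) (A B : set T) : finite_set A -> finite_set B ->
  A `&` B `<=` set0 -> icount (A `|` B) = icount A + icount B.
Proof. by move=> fA fB AB; rewrite /icount fsbigU0. Qed.

Lemma icount_image (T U : choiceType) (f : T -> U) (A : set T) : injective f ->
  icount (f @` A) = icount A.
Proof. by move=> fI; rewrite /icount fsbig_image // => x y _ _; exact: fI. Qed.

Lemma icount_seq (T : choiceType) (r : seq T) : uniq r ->
  icount [set` r] = (size r)%:R.
Proof.
by move=> ur; rewrite /icount -fsbig_seq // big_const_seq count_predT iter_addr_0.
Qed.

Lemma icount_bigcup (T : choiceType) (I : eqType) (r : seq I) (A : I -> set T) :
  uniq r -> (forall i, i \in r -> finite_set (A i)) ->
  (forall i j x, i \in r -> j \in r -> A i x -> A j x -> i = j) ->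
  finite_set [set x | exists2 i, i \in r & A i x] /\
  icount [set x | exists2 i, i \in r & A i x] = \sum_(i <- r) icount (A i).
Proof.
elim: r => [|i r IHr] ur fA dA.
  have -> : [set x | exists2 i, i \in [::] & A i x] = set0.
    by rewrite -subset0 => x [].
  by rewrite icount0 big_nil.
have -> : [set x | exists2 j, j \in i :: r & A j x] =
    A i `|` [set x | exists2 j, j \in r & A j x].
  apply/seteqP; split => x /=.
    move=> [j]; rewrite inE => /predU1P[->|jr] Ax; [by left|by right; exists j].
  move=> [Ax|[j jr Ax]]; first by exists i; rewrite ?mem_head.
  by exists j => //; rewrite inE jr orbT.
move: ur => /= /andP[ir ur].
have fAi : finite_set (A i) by apply: fA; rewrite mem_head.
have [|||f1 f2] := IHr => //.
- by move=> j jr; apply: fA; rewrite inE jr orbT.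
- by move=> j k x jr kr; apply: dA; rewrite inE ?jr ?kr orbT.
split; first by rewrite finite_setU.
rewrite icountU // ?f2 ?big_cons // => x [Ax [j jr Ajx]].
by move: ir; rewrite (dA i j x) ?mem_head ?jr // inE jr orbT.
Qed.

Lemma finite_int_box n (A : set 'rV[int]_n) (M : R) :
  (forall z, A z -> forall i, `|(z ord0 i)%:~R| <= M) -> finite_set A.
Proof.
move=> AM; pose N := Num.trunc `|M|.
pose f (h : {ffun 'I_n -> 'I_(N.+1 + N)}) : 'rV[int]_n := \row_i ((h i)%:Z - N%:Z).
apply: (@sub_finite_set _ _ (range f)); last exact: finite_image.
move=> z Az; have zN i : (`|z ord0 i| <= N)%N.
  rewrite /N -[X in (X <= _)%N](@natrK R); apply: le_truncn.
  rewrite natr_absz intr_norm; apply: le_trans (AM z Az i) _; exact: ler_norm.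
have zb i : (`|(z ord0 i + N%:Z)%R| < N.+1 + N)%N.
  have := zN i; move: (z ord0 i) => u; lia.
exists [ffun i => Ordinal (zb i)] => //; apply/rowP => i; rewrite mxE ffunE /=.
have := zN i; move: (z ord0 i) => u; lia.
Qed.

(** Polynomials of degree less than m, in the binomial basis because antidifferences and alternating
    sums are explicit there. *)
Definition pdeg m (f : nat -> R) :=
  exists a : nat -> R, forall k, f k = \sum_(i < m) a i * 'C(k, i)%:R.

Lemma pdeg0 m : pdeg m (fun=> 0).
Proof. by exists (fun=> 0) => k; rewrite big1 // => i _; rewrite mul0r. Qed.

Lemma pdegD m f g : pdeg m f -> pdeg m g -> pdeg m (fun k => f k + g k).
Proof.
move=> [a fa] [b gb]; exists (fun i => a i + b i) => k.
by rewrite fa gb -big_split; apply: eq_bigr => i _; rewrite mulrDl.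
Qed.

Lemma pdegZ m c f : pdeg m f -> pdeg m (fun k => c * f k).
Proof.
move=> [a fa]; exists (fun i => c * a i) => k.
by rewrite fa mulr_sumr; apply: eq_bigr => i _; rewrite mulrA.
Qed.

Lemma pdeg_sum m (I : Type) (r : seq I) (P : pred I) (f : I -> nat -> R) :
  (forall i, P i -> pdeg m (f i)) -> pdeg m (fun k => \sum_(i <- r | P i) f i k).
Proof.
move=> mf; elim: r => [|i r IHr].
  by under eq_fun do rewrite big_nil; exact: pdeg0.
under eq_fun do rewrite big_cons.
by case: (boolP (P i)) => // Pi; apply: pdegD => //; exact: mf.
Qed.

Lemma pdegW m m' f : (m <= m')%N -> pdeg m f -> pdeg m' f.
Proof.
move=> mm' [a fa]; exists (fun i => if (i < m)%N then a i else 0) => k.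
rewrite fa (big_ord_widen _ (fun i => a i * 'C(k, i)%:R) mm') big_mkcond /=.
by apply: eq_bigr => i _; case: ifP => // _; rewrite mul0r.
Qed.

Lemma pdeg_bin m i : (i < m)%N -> pdeg m (fun k => 'C(k, i)%:R).
Proof.
move=> im; exists (fun j => (j == i)%:R) => k.
rewrite (bigD1 (Ordinal im)) //= eqxx mul1r big1 ?addr0 // => j ji.
by rewrite -[_ == _]/(j == Ordinal im :> nat) (negPf (ji : (j : nat) != i)) mul0r.
Qed.

Lemma pdeg_cst m c : (0 < m)%N -> pdeg m (fun=> c).
Proof.
move=> m0; have [a fa] := pdegZ c (pdeg_bin m0).
by exists a => k; rewrite -fa bin0 mulr1.
Qed.

(** The hockey-stick identity; the correction is the term l = 0 left out by the shift. *)
Lemma sum_bin k i : \sum_(l < k) ('C(l.+1, i)%:R : R) = 'C(k.+1, i.+1)%:R - (i == 0)%:R.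
Proof.
elim: k => [|k IHk]; first by rewrite big_ord0 binS bin0n; case: i => [|i]; rewrite ?bin0n /= ?subrr.
by rewrite big_ord_recr /= IHk [in RHS]binS natrD addrAC.
Qed.

Lemma pdeg_antidiff m f c : pdeg m f -> pdeg m.+1 (fun k => c + \sum_(l < k) f l.+1).
Proof.
move=> [a fa]; apply: pdegD; first exact: pdeg_cst.
have -> : (fun k => \sum_(l < k) f l.+1) = (fun k => \sum_(i < m)
    a i * ('C(k, i.+1)%:R + 'C(k, i)%:R + - (i == 0 :> nat)%:R)).
  apply/funext => k; under eq_bigr do rewrite fa.
  rewrite exchange_big /=; apply: eq_bigr => i _.
  by rewrite -mulr_sumr sum_bin binS natrD.
apply: pdeg_sum => i _; apply: pdegZ; apply: pdegD; last exact: pdeg_cst.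
apply: pdegD; apply: pdeg_bin; first exact: ltn_ord.
exact: ltnW (ltn_ord i).
Qed.

(** Pascal's rule splits each binomial coefficient, and the halves recombine to differences.
    Iterated, this exhibits the alternating sum as a higher forward difference, each step of which
    lowers i in ['C(k, i)]. *)
Lemma altsum_step d (f : nat -> R) :
  \sum_(k < d.+2) (-1) ^+ k * 'C(d.+1, k)%:R * f k =
  - \sum_(k < d.+1) (-1) ^+ k * 'C(d, k)%:R * (f k.+1 - f k).
Proof.
rewrite big_ord_recl /= !bin0 expr0 !mul1r.
under eq_bigr => k _ do rewrite /bump /= add1n binS natrD mulrDr mulrDl.
rewrite big_split /= addrA.
under [in RHS]eq_bigr do rewrite mulrBr.
rewrite sumrB opprB; congr (_ + _); last first.
  by rewrite -sumrN; apply: eq_bigr => k _; rewrite exprS !mulN1r !mulNr.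
rewrite big_ord_recr /= (bin_small (ltnSn d)) mulr0 mul0r addr0.
by rewrite [RHS]big_ord_recl /= expr0 bin0 !mul1r.
Qed.

Lemma altsum_bin d i : (i <= d)%N ->
  \sum_(k < d.+1) (-1) ^+ k * 'C(d, k)%:R * 'C(k, i)%:R =
  (-1) ^+ d * (i == d)%:R :> R.
Proof.
elim: d i => [|d IHd] i.
  by rewrite leqn0 => /eqP ->; rewrite big_ord1 !bin0 expr0 !mul1r.
rewrite (altsum_step d (fun k => 'C(k, i)%:R)); case: i => [_|i id].
  rewrite mulr0 big1 ?oppr0 // => k _.
  by rewrite !bin0 subrr mulr0.
under eq_bigr => k _ do rewrite binS natrD addrAC subrr add0r.
by rewrite IHd // exprS mulN1r mulNr.
Qed.

Lemma altsum_pdeg d (f a : nat -> R) :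
  (forall k, f k = \sum_(i < d.+1) a i * 'C(k, i)%:R) ->
  \sum_(k < d.+1) (-1) ^+ k * 'C(d, k)%:R * f k = (-1) ^+ d * a d.
Proof.
move=> fa; under eq_bigr do rewrite fa mulr_sumr.
rewrite exchange_big /= (bigD1 ord_max) //= [X in _ + X]big1 => [|i].
  under eq_bigr do rewrite mulrCA.
  by rewrite -mulr_sumr altsum_bin // eqxx mulr1 addr0 mulrC.
move=> im; under eq_bigr do rewrite mulrCA.
rewrite -mulr_sumr altsum_bin; last by rewrite -ltnS.
by rewrite (negPf (im : (i : nat) != d)) !mulr0.
Qed.

End Counting.

(** * Ehrhart polynomials of relative interiors *)

Section Ehrhart.
Variables (R : realType) (n : nat).
Local Notation V := 'rV[R]_n.

Definition rz (z : 'rV[int]_n) : V := map_mx (fun m : int => (m%:~R : R)) z.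

Lemma rz_inj : injective rz.
Proof.
move=> x y /rowP xy; apply/rowP => i; have := xy i; rewrite !mxE.
by move/eqP; rewrite eqr_int => /eqP.
Qed.

Lemma rzD x y : rz (x + y) = rz x + rz y.
Proof. by apply/rowP => i; rewrite !mxE intrD. Qed.

Lemma rzB x y : rz (x - y) = rz x - rz y.
Proof. by apply/rowP => i; rewrite !mxE intrB. Qed.

Lemma rz_sum N (F : 'I_N -> 'rV[int]_n) : rz (\sum_i F i) = \sum_i rz (F i).
Proof.
by apply/rowP => j; rewrite !mxE !summxE rmorph_sum; apply: eq_bigr => i _; rewrite mxE.
Qed.

Lemma integral_rz (x : V) : Defs.integral x -> exists z, x = rz z.
Proof.
move=> ix; have H i : exists m : int, x ord0 i = m%:~R by apply/intrP; exact: ix.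
have [f fE] := choice H; exists (\row_i f i).
by apply/rowP => i; rewrite !mxE -fE.
Qed.

Lemma rz_integral z : Defs.integral (rz z).
Proof. by move=> i; rewrite mxE; apply/intrP; exists (z ord0 i). Qed.

Lemma finite_scaled (P : set V) (k : nat) : (0 < k)%N -> bounded P ->
  finite_set [set z | P (k%:R^-1 *: rz z)].
Proof.
move=> k0 [M PM]; apply: (@finite_int_box R n _ (k%:R * M)) => z /= /PM H i.
have kR : 0 < k%:R :> R by rewrite ltr0n.
have := H i; rewrite !mxE normrM normfV normr_nat.
by rewrite mulrC ler_pdivrMr // mulrC.
Qed.

Lemma hull_bounded N (s : 'I_N -> V) : bounded (hull s).
Proof.
exists (\sum_i \sum_j `|s i ord0 j|) => x [w [w0 [w1 ->]]] j.
rewrite summxE; apply: le_trans (ler_norm_sum _ _ _) _.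
apply: ler_sum => i _; rewrite mxE normrM ger0_norm //.
have wi : w i <= 1 by rewrite -w1 (bigD1 i) //= lerDl sumr_ge0.
apply: le_trans (_ : `|s i ord0 j| <= _); first by rewrite ler_piMl.
by rewrite (bigD1 j) //= lerDl sumr_ge0.
Qed.

Lemma sub_bounded (P C : set V) : C `<=` P -> bounded P -> bounded C.
Proof. by move=> CP [M PM]; exists M => x /CP; exact: PM. Qed.

Section Simplex.
Variables (d : nat) (t : 'I_d.+1 -> 'rV[int]_n).
Hypothesis ft : affree (fun i => rz (t i)).
Implicit Types (A : {set 'I_d.+1}).

(* Splitting off the points with w i <= 1 (translation by t i identifies the
   others with the region of k - 1) moves i into A: see region_step. *)
Definition region A (k : nat) : set 'rV[int]_n :=
  [set z | exists w : 'I_d.+1 -> R,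
    [/\ forall i, 0 < w i, forall i, i \in A -> w i <= 1, \sum_i w i = k%:R &
        rz z = \sum_i w i *: rz (t i)]].

Lemma region_finite A k : finite_set (region A k).
Proof.
apply: (@finite_int_box R n _ (\sum_i \sum_j k%:R * `|rz (t i) ord0 j|)).
move=> z [w [w0 _ w1 zE]] j; have -> : ((z ord0 j)%:~R : R) = rz z ord0 j by rewrite mxE.
rewrite zE summxE; apply: le_trans (ler_norm_sum _ _ _) _.
apply: ler_sum => i _; rewrite mxE normrM gtr0_norm //.
have wi : w i <= k%:R.
  by rewrite -w1 (bigD1 i) //= lerDl sumr_ge0 // => l _; exact: ltW.
apply: le_trans (_ : k%:R * `|rz (t i) ord0 j| <= _); first by rewrite ler_wpM2r.
by rewrite (bigD1 j) //= lerDl sumr_ge0.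
Qed.

Lemma affree_uniq (w v : 'I_d.+1 -> R) : \sum_i w i = \sum_i v i ->
  \sum_i w i *: rz (t i) = \sum_i v i *: rz (t i) -> w =1 v.
Proof.
move=> wv wvt i; apply/eqP; rewrite -subr_eq0.
have -> // := ft (l := fun i => w i - v i); first by rewrite sumrB wv subrr.
by under eq_bigr do rewrite scalerBl; rewrite sumrB wvt subrr.
Qed.

Lemma region_step A k i : i \notin A ->
  icount R (region A k.+1) = icount R (region (i |: A) k.+1) + icount R (region A k).
Proof.
move=> iA.
have sumi (w : 'I_d.+1 -> R) c :
    \sum_j (if j == i then w j + c else w j) = \sum_j w j + c.
  rewrite (bigD1 i) //= eqxx [in RHS](bigD1 i) //= addrAC; congr (_ + _ + _).
  by apply: eq_bigr => j /negPf ->.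
have sumit (w : 'I_d.+1 -> R) c :
    \sum_j (if j == i then w j + c else w j) *: rz (t j) =
    \sum_j w j *: rz (t j) + c *: rz (t i).
  rewrite (bigD1 i) //= eqxx [in RHS](bigD1 i) //= scalerDl addrAC; congr (_ + _ + _).
  by apply: eq_bigr => j /negPf ->.
rewrite -(@icount_image R _ _ (fun z => z + t i) (region A k)); last exact: addIr.
rewrite -icountU; first last.
- move=> z [[w [w0 wA w1 zE]] [y [v [v0 vA v1 yE]] yz]].
  have : w =1 (fun j => if j == i then v j + 1 else v j).
    apply: affree_uniq; first by rewrite w1 sumi v1 -natr1.
    by rewrite -zE sumit -yz rzD yE scale1r.
  move=> /(_ i); rewrite eqxx => wi.
  have := wA i; rewrite in_setU1 eqxx => /(_ isT); rewrite wi.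
  by rewrite gerDr leNgt v0.
- by apply: finite_image; exact: region_finite.
- exact: region_finite.
congr icount; apply/seteqP; split => z.
  move=> [w [w0 wA w1 zE]]; have [wi|wi] := leP (w i) 1.
    left; exists w; split => // j; rewrite in_setU1 => /predU1P[->//|]; exact: wA.
  right; exists (z - t i); last exact: subrK.
  exists (fun j => if j == i then w j + -1 else w j); split.
  - by move=> j; case: eqP => [->|_ //]; rewrite subr_gt0.
  - by move=> j jA; case: eqP jA => [->|_]; [rewrite (negPf iA)|exact: wA].
  - by rewrite sumi w1 -natr1 addrK.
  - by rewrite sumit rzB zE scaleN1r.
move=> [[w [w0 wA w1 zE]]|[y [w [w0 wA w1 yE]] <-]].
  by exists w; split => // j jA; apply: wA; rewrite in_setU1 jA orbT.
exists (fun j => if j == i then w j + 1 else w j); split.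
- by move=> j; case: eqP => // _; rewrite addr_gt0.
- by move=> j jA; case: eqP jA => [->|_]; [rewrite (negPf iA)|exact: wA].
- by rewrite sumi w1 natr1.
- by rewrite sumit rzD yE scale1r.
Qed.

Lemma region_full k : (d.+1 < k)%N -> icount R (region [set: 'I_d.+1]%SET k) = 0.
Proof.
move=> dk; rewrite (_ : region _ _ = set0) ?icount0 // -subset0 => z.
move=> [w [_ wA w1 _]].
have : \sum_i w i <= \sum_(i < d.+1) 1 by apply: ler_sum => i _; apply: wA; rewrite finset.in_setT.
by rewrite w1 sumr_const card_ord ler_nat leqNgt dk.
Qed.

(** Weights at most 1 whose sum equals their number are all 1. This single point is the source of
    the sign at 0. *)
Lemma region_top : icount R (region [set: 'I_d.+1]%SET d.+1) = 1.
Proof.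
rewrite (_ : region _ _ = [set \sum_i t i]) ?icount1 //.
apply/seteqP; split => z /=; last first.
  move=> ->; exists (fun=> 1); split => //.
    by rewrite sumr_const card_ord.
  by rewrite rz_sum; apply: eq_bigr => i _; rewrite scale1r.
move=> [w [w0 wA w1 zE]]; apply: rz_inj; rewrite zE rz_sum.
have w1' i : 0 <= 1 - w i by rewrite subr_ge0 wA // finset.in_setT.
have : \sum_i (1 - w i) = 0 by rewrite sumrB w1 sumr_const card_ord subrr.
move=> /eqP; rewrite psumr_eq0 // => /allP H.
apply: eq_bigr => i _; have := H i (mem_index_enum i).
by rewrite /= subr_eq0 => /eqP <-; rewrite scale1r.
Qed.

(* The counting function deviates from its polynomial at k = #|A| by the single
   point with all coordinates 1; summation propagates it down to k = 0. *)
Lemma region_pdeg m A : #|~: A| = m -> exists p : nat -> R,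
  [/\ pdeg m p, forall k, (#|A| < k)%N -> p k = icount R (region A k) &
      p #|A| = icount R (region A #|A|) - (-1) ^+ m].
Proof.
elim: m A => [|m IHm] A Am.
  have -> : A = [set: 'I_d.+1]%SET.
    by apply: finset.setC_inj; rewrite finset.setCT; apply/eqP; rewrite -cards_eq0 Am.
  rewrite cardsT card_ord; exists (fun=> 0); split; first exact: pdeg0.
    by move=> k /region_full ->.
  by rewrite region_top expr0 subrr.
have [i iA] : exists i, i \in ~: A by apply/card_gt0P; rewrite Am.
have iA' : i \notin A by rewrite inE in iA.
have cA : #|i |: A| = #|A|.+1 by rewrite cardsU1 iA'.
have [|p [pm pk pA]] := IHm (i |: A).
  have : (#|i |: A| + #|~: (i |: A)| = #|A| + #|~: A|)%N by rewrite !cardsC.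
  by rewrite cA Am; lia.
rewrite cA in pk pA.
(* This constant makes the antidifference correct at k = |A| + 1; [region_step] carries this
   upwards, while one step down it picks up the deviation of [p] at |A| + 1. *)
pose c := icount R (region A #|A|.+1) - \sum_(l < #|A|.+1) p l.+1.
exists (fun k => c + \sum_(l < k) p l.+1); split; first exact: pdeg_antidiff.
  elim=> // k IHk; rewrite ltnS leq_eqVlt => /predU1P[<-|Ak].
    by rewrite /c subrK.
  by rewrite big_ord_recr /= addrA IHk // pk ?ltnS // addrC (@region_step A k i).
rewrite /c big_ord_recr /= pA (@region_step A _ i) // exprS.
by ring.
Qed.

(** The case of empty A. At k = 0 there are no points, because d + 1 positive weights cannot sum to
    0, so only the deviation -(-1)^(d+1) is left. *)
Lemma osim_count : exists p : nat -> R, [/\ pdeg d.+1 p,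
  forall k, (0 < k)%N ->
    p k = icount R [set z | osim (fun i => rz (t i)) (k%:R^-1 *: rz z)] &
  p 0 = (-1) ^+ d].
Proof.
have [|p [pm pk p0]] := @region_pdeg d.+1 finset.set0.
  by rewrite finset.setC0 cardsT card_ord.
rewrite cards0 in pk p0.
exists p; split => //; last first.
  rewrite p0 (_ : region _ _ = set0) ?icount0 ?sub0r ?exprS ?mulN1r ?opprK //.
  rewrite -subset0 => z [w [w0 _ /eqP]]; rewrite psumr_eq0 => [/allP H|i _]; last exact: ltW.
  have := H ord0 (mem_index_enum _); rewrite /= => /eqP w00.
  by have := w0 ord0; rewrite w00 ltxx.
move=> k k0; rewrite pk //; congr icount.
have kR : 0 < k%:R :> R by rewrite ltr0n.
have kn0 : k%:R != 0 :> R by rewrite gt_eqF.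
apply/seteqP; split => z [w].
  move=> [w0 _ w1 zE]; exists (fun i => k%:R^-1 * w i); split.
  - by move=> i; rewrite mulr_gt0 ?invr_gt0.
  - by rewrite -mulr_sumr w1 mulVf.
  - by rewrite zE scaler_sumr; apply: eq_bigr => i _; rewrite scalerA.
move=> [w0 w1 zE]; exists (fun i => k%:R * w i); split.
- by move=> i; rewrite mulr_gt0.
- by move=> i; rewrite inE.
- by rewrite -mulr_sumr w1 mulr1.
- rewrite -[LHS](scalerKV kn0) zE scaler_sumr.
  by apply: eq_bigr => i _; rewrite scalerA.
Qed.

End Simplex.

Theorem relint_ehrhart N (s : 'I_N -> V) : (0 < N)%N ->
  (forall i, Defs.integral (s i)) ->
  exists p : nat -> R, [/\ pdeg (dimc (hull s)).+1 p,
    forall k, (0 < k)%N ->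
      p k = icount R [set z | relint (hull s) (k%:R^-1 *: rz z)] &
    p 0 = (-1) ^+ dimc (hull s)].
Proof.
move=> N0 si; have [TT [d [t [fT tT oT rT uT]]]] := relint_hull_triangulation s.
have H T : exists p : nat -> R, T \in TT -> [/\ pdeg (d T).+1 p,
    forall k, (0 < k)%N ->
      p k = icount R [set z | osim (t T) (k%:R^-1 *: rz z)] & p 0 = (-1) ^+ d T].
  have [TTT|_] := boolP (T \in TT); last by exists (fun=> 0).
  have iz j : exists z, t T j = rz z.
    by have [i ->] := tT T TTT j; apply: integral_rz; exact: si.
  have [u uE] := choice iz; have tE : t T = fun j => rz (u j) by apply/funext.
  have := fT T TTT; rewrite tE => fu.
  by have [p [p1 p2 p3]] := osim_count fu; exists p.
have [p pE] := choice H.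
have dT T : T \in TT -> (d T <= dimc (hull s))%N.
  move=> TTT; apply: affind_dimc; exists (t T); split.
    by move=> j; have [i ->] := tT T TTT j; exact: hull_in.
  exact: affree_rank (fT T TTT).
have hb := hull_bounded s.
have x0 := relint_hull_nonempty s N0.
exists (fun k => \sum_(T in TT) p T k); split.
- apply: pdeg_sum => T TTT; have [pd _ _] := pE T TTT.
  by apply: pdegW pd; rewrite ltnS dT.
- move=> k k0.
  rewrite (eq_bigr (fun T => icount R [set z | osim (t T) (k%:R^-1 *: rz z)])).
    rewrite -big_enum /=.
    have [||| _ <-] := @icount_bigcup R _ _ (enum TT)
      (fun T => [set z | osim (t T) (k%:R^-1 *: rz z)]).
    + exact: enum_uniq.
    + move=> T; rewrite mem_enum => TTT; apply: finite_scaled => //.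
      by apply: sub_bounded hb => x /(oT T TTT)/relint_sub.
    + by move=> T T' z; rewrite !mem_enum => TTT TTT'; exact: uT.
    congr icount; apply/seteqP; split => z /=.
      by move=> [T]; rewrite mem_enum => TTT; exact: oT.
    by move=> /rT[T TTT oTz]; exists T; rewrite ?mem_enum.
  by move=> T TTT; have [_ pk _] := pE T TTT; exact: pk.
- have [U [rU _ rocU]] := relint_roc (@hull_cvx _ _ _ s) (relint_sub x0).
  have [_] := roc_Chi rocU (sub_bounded (@relint_sub _ _ _) hb).
  rewrite asboolT ?rU; last by exists (N%:R^-1 *: \sum_i s i).
  move=> <-.
  (* The disjoint cover by simplices becomes an identity of indicator functions, which is what
     additivity of [Chi] needs. *)
  have -> : ind (relint (hull s)) = fun x => \sum_(T in TT) ind (osim (t T)) x.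
    apply/funext => x; rewrite {1}/ind; case: asboolP => [rx|rx].
      have [T TTT oTx] := rT x rx.
      rewrite (bigD1 T) //= /ind asboolT // big1 ?addr0 // => T' /andP[TTT' TT'].
      by rewrite asboolF // => oTx'; case/eqP: TT'; exact: uT oTx' oTx.
    rewrite big1 // => T TTT; rewrite /ind asboolF // => /(oT T TTT) //.
  have oC T : T \in TT -> tame (ind (osim (t T))) /\
      Chi (ind (osim (t T))) = (-1) ^+ d T.
    move=> TTT; have [|t1 ->] := roc_Chi (simplex_roc (t T)).
      by apply: sub_bounded hb => x /(oT T TTT)/relint_sub.
    split => //; rewrite asboolT ?affree_rank //; first exact: fT.
    exists ((d T).+1%:R^-1 *: \sum_i t T i).
    exists (fun=> (d T).+1%:R^-1); split.
    + by move=> i; rewrite invr_gt0 ltr0n.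
    + by rewrite sumr_const card_ord -[_ *+ _]mulr_natr mulVf // pnatr_eq0.
    + by rewrite scaler_sumr.
  rewrite Chi_sum; last by move=> T /oC[].
  by apply: eq_bigr => T TTT; have [_ ->] := oC T TTT; have [_ _ ->] := pE T TTT.
Qed.

End Ehrhart.

(** * Volume by counting grid points *)

Section Lvol.
Variable R : realType.

Lemma lvol_ge0 d (S : set 'rV[R]_d) : (0 <= lvol S)%E.
Proof.
elim: d S => [|d IHd] S /=; first by case: asboolP.
by apply: integral_ge0 => x _; exact: IHd.
Qed.

(** The integral of a nonnegative function is a supremum over simple functions below it, hence
    monotone for arbitrary functions, such as the section volumes in [lvol]. *)
Lemma le_nonneg_integral (f g : R -> \bar R) :
  (forall x, 0 <= f x)%E -> (forall x, f x <= g x)%E ->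
  (\int[@lebesgue_measure R]_x f x <= \int[@lebesgue_measure R]_x g x)%E.
Proof.
move=> f0 fg; have g0 x : (0 <= g x)%E by exact: le_trans (fg x).
rewrite !ge0_integralTE //; apply: le_ereal_sup => r [h hf <-].
by exists h => // x; exact: le_trans (fg x).
Qed.

Lemma le_lvol d (S S' : set 'rV[R]_d) : S `<=` S' -> (lvol S <= lvol S')%E.
Proof.
elim: d S S' => [|d IHd] S S' SS' /=.
  by case: asboolP => [/SS' S'0|_]; [rewrite asboolT|case: asboolP].
apply: le_nonneg_integral => x; first exact: lvol_ge0.
by apply: IHd => y /=; exact: SS'.
Qed.

(** Index of the grid cube of side [l], for the grid with origin [a], that contains [y]. The floor
    makes the cubes half-open, so they tile the space without overlap. *)
Definition cellof d (a : 'rV[R]_d) (l : R) (y : 'rV[R]_d) : 'rV[int]_d :=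
  \row_i Num.floor ((y ord0 i - a ord0 i) / l).

(** A section is again a union of grid cubes, one dimension lower, and depends only on the cell of
    its first coordinate. The outer integrand is thus a step function: a sum over [M] of multiples
    of indicators of intervals of length [l]. *)
Lemma lvol_grid d (a : 'rV[R]_d) (l : R) (M : seq 'rV[int]_d) : 0 < l -> uniq M ->
  lvol [set y | cellof a l y \in M] = ((size M)%:R * l ^+ d)%:E.
Proof.
move=> l0; elim: d a M => [|d IHd] a M uM.
  rewrite /= expr0 mulr1; have all0 (x y : 'rV[int]_0) : x = y by apply/rowP => -[].
  case: M uM => [|x [|y M]] /=; last by rewrite (all0 y x) mem_head.
    by move=> _; rewrite asboolF.
  by move=> _; rewrite asboolT // (all0 (cellof _ _ _) x) mem_head.
pose a' : 'rV[R]_(1 + d) := a.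
pose a0 := a' ord0 (lshift d ord0).
pose hd (m : 'rV[int]_(1 + d)) : int := m ord0 (lshift d ord0).
pose tl (m : 'rV[int]_(1 + d)) : 'rV[int]_d := rsubmx m.
pose Mi (i : int) : seq 'rV[int]_d := [seq tl m | m <- M & hd m == i].
have mE (m : 'rV[int]_(1 + d)) : m = row_mx (const_mx (hd m) : 'rV_1) (tl m).
  rewrite -[LHS]hsubmxK; congr (row_mx _ _).
  by apply/rowP => i; rewrite !mxE ord1.
have cE x (y : 'rV[R]_d) :
    cellof a' l (row_mx (const_mx x : 'rV[R]_1) y) =
    row_mx (const_mx (Num.floor ((x - a0) / l)) : 'rV_1) (cellof (rsubmx a') l y).
  apply/rowP => j; case: (split_ordP j) => k ->.
    by rewrite [RHS]row_mxEl [RHS]mxE [LHS]mxE row_mxEl [in LHS]mxE /a0 (ord1 k).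
  by rewrite [RHS]row_mxEr [RHS]mxE [LHS]mxE row_mxEr [in RHS]mxE.
have hdE i m : hd (row_mx (const_mx i : 'rV[int]_1) m) = i by rewrite /hd row_mxEl mxE.
have tlE i m : tl (row_mx (const_mx i : 'rV[int]_1) m) = m by rewrite /tl row_mxKr.
have uMi i : uniq (Mi i).
  rewrite map_inj_in_uniq ?filter_uniq // => u v.
  rewrite !mem_filter => /andP[/eqP ui _] /andP[/eqP vi _] uv.
  by rewrite (mE u) (mE v) ui vi uv.
have slE x : [set y : 'rV[R]_d | [set y | cellof a l y \in M]
      (row_mx (const_mx x : 'rV[R]_1) y)] =
    [set y | cellof (rsubmx a') l y \in Mi (Num.floor ((x - a0) / l))].
  apply/seteqP; split => y /=; rewrite -/a'; move: (cE x y) => cExy.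
    move=> My; apply/mapP; exists (cellof a' l (row_mx (const_mx x : 'rV[R]_1) y)).
      by rewrite mem_filter My andbT cExy hdE.
    by rewrite cExy tlE.
  move=> /mapP[m]; rewrite mem_filter => /andP[/eqP mi mM] mt.
  by rewrite [X in X \in _]cExy -mi mt -mE.
pose I (m : 'rV[int]_(1 + d)) : set R :=
  [set` `[a0 + l * (hd m)%:~R, a0 + l * (hd m + 1)%:~R[].
have szE x : (((size (Mi (Num.floor ((x - a0) / l))))%:R * l ^+ d)%:E =
    \sum_(m <- M) ((l ^+ d)%:E * (\1_(I m) x)%:E) :> \bar R)%E.
  rewrite size_map size_filter -sum1_count natr_sum big_mkcond /= mulr_suml -sumEFin.
  apply: eq_bigr => m _; rewrite -EFinM mulrC indicE; congr ((_ * _)%:E).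
  have -> : (x \in I m) = (hd m == Num.floor ((x - a0) / l)).
    rewrite eq_sym floor_eq mem_setE in_itv /=.
    by rewrite ler_pdivlMr // ltr_pdivrMr // lerBrDl ltrBlDl ![_%:~R * l]mulrC.
  by case: eqP.
rewrite /=; under eq_integral => x _ do rewrite slE IHd // szE.
have mI m : measurable (I m) by exact: measurable_itv.
rewrite ge0_integral_sum //; first last.
- by move=> m x _; rewrite mule_ge0 ?lee_fin ?exprn_ge0 // ltW.
- move=> m; apply: measurable_funeM.
  by apply/measurable_EFinP; apply: measurable_indic; exact: mI.
have IE m : (\int[@lebesgue_measure R]_x (\1_(I m) x)%:E = l%:E)%E.
  have := @integral_indic _ _ R (@lebesgue_measure R) setT measurableT (I m).
  move=> /(_ (measurable_itv _)); rewrite setIT => ->.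
  apply: etrans; first exact: lebesgue_measure_itv.
  rewrite /= lte_fin.
  rewrite ltrD2l ltr_pM2l // ltr_int ltrDl ltr01.
  by rewrite -EFinD intrD; congr (_%:E); ring.
have intE m : (\int[@lebesgue_measure R]_x ((l ^+ d)%:E * (\1_(I m) x)%:E) =
    (l ^+ d.+1)%:E)%E.
  rewrite ge0_integralZl //.
  - by rewrite IE -EFinM exprSr.
  - by apply/measurable_EFinP; apply: measurable_indic; exact: mI.
  - by rewrite lee_fin exprn_ge0 // ltW.
under eq_bigr do rewrite intE.
by rewrite sumEFin big_const_seq count_predT iter_addr_0 mulr_natl.
Qed.

End Lvol.

(** * Leading coefficients as limits *)

Section Leading.
Import numFieldNormedType.Exports.
Variable R : realType.
Implicit Types (f a : nat -> R).

Local Notation h := (@harmonic R).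

Lemma cvg_bin i :
  (fun n => 'C(n.+1, i)%:R * h n ^+ i) @ \oo --> (i`!%:R^-1 : R).
Proof.
elim: i => [|i IHi].
  rewrite fact0 invr1 (_ : (fun n => _) = fun=> 1); first exact: cvg_cst.
  by apply/funext => n; rewrite bin0 expr0 mulr1.
have -> : (fun n => 'C(n.+1, i.+1)%:R * h n ^+ i.+1) =
    (fun n => ('C(n.+1, i)%:R * h n ^+ i) * ((1 - i%:R * h n) * i.+1%:R^-1)).
  apply/funext => n; rewrite /harmonic /=.
  have n0 : (n.+1%:R : R) != 0 by rewrite pnatr_eq0.
  have i0 : (i.+1%:R : R) != 0 by rewrite pnatr_eq0.
  apply: (mulfI i0); rewrite mulrA -natrM mul_bin_left.
  (* For n + 1 < i the natural subtraction truncates, but the binomial coefficient then vanishes on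
     both sides. *)
  have [ni|ni] := ltnP n.+1 i; first by rewrite bin_small // muln0 !mul0r mulr0.
  rewrite natrM natrB // exprS; move: (n.+1%:R : R) (i.+1%:R : R) n0 i0 => x y x0 y0.
  by field; rewrite x0 y0.
have -> : (i.+1`!%:R^-1 : R) = i`!%:R^-1 * ((1 - i%:R * 0) * i.+1%:R^-1).
  by rewrite mulr0 subr0 mul1r factS natrM invfM mulrC.
apply: cvgM => //; apply: cvgM; last exact: cvg_cst.
apply: cvgB; first exact: cvg_cst.
by apply: cvgM; [exact: cvg_cst|exact: cvg_harmonic].
Qed.

Lemma cvg_leading d f a :
  (forall k, f k = \sum_(i < d.+1) a i * 'C(k, i)%:R) ->
  (fun n => f n.+1 * h n ^+ d) @ \oo --> a d / d`!%:R.
Proof.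
move=> fa; have -> : (fun n => f n.+1 * h n ^+ d) =
    (fun n => (\sum_(i < d.+1) a i * 'C(n.+1, i)%:R) * h n ^+ d).
  by apply/funext => n; rewrite fa.
elim: d {fa} => [|d IHd].
  have -> : (fun n => (\sum_(i < 1) a i * 'C(n.+1, i)%:R) * h n ^+ 0) =
      (fun n => a 0 * ('C(n.+1, 0)%:R * h n ^+ 0)).
    by apply/funext => n; rewrite big_ord1 mulrA.
  by apply: cvgM; [exact: cvg_cst|exact: cvg_bin].
have -> : (fun n => (\sum_(i < d.+2) a i * 'C(n.+1, i)%:R) * h n ^+ d.+1) =
    (fun n => (\sum_(i < d.+1) a i * 'C(n.+1, i)%:R) * h n ^+ d * h n +
              a d.+1 * ('C(n.+1, d.+1)%:R * h n ^+ d.+1)).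
  apply/funext => n; rewrite big_ord_recr /= mulrDl mulrA.
  by rewrite -[_ * h n ^+ d * _]mulrA -exprSr.
rewrite -[X in _ --> X]add0r -[X in X + _](mulr0 (a d / d`!%:R)).
apply: cvgD; first by apply: cvgM => //; exact: cvg_harmonic.
by apply: cvgM; [exact: cvg_cst|exact: cvg_bin].
Qed.

Lemma cvg_pow_perturb (c : R) d : (fun n => (1 + c * h n) ^+ d) @ \oo --> (1 : R).
Proof.
elim: d => [|d IHd].
  rewrite (_ : (fun n => _) = fun=> 1); first exact: cvg_cst.
  by apply/funext => n; rewrite expr0.
have -> : (fun n => (1 + c * h n) ^+ d.+1) =
    (fun n => (1 + c * h n) * (1 + c * h n) ^+ d).
  by apply/funext => n; rewrite exprS.
rewrite -[X in _ --> X]mulr1; apply: cvgM => //.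
rewrite -[X in _ --> X]addr0 -[X in _ + X](mulr0 c).
apply: cvgD; first exact: cvg_cst.
by apply: cvgM; [exact: cvg_cst|exact: cvg_harmonic].
Qed.

Lemma leading_coef_sandwich d f a (V : R) (q : nat) :
  (forall k, f k = \sum_(i < d.+1) a i * 'C(k, i)%:R) ->
  (forall k, (q < k)%N ->
     (k%:R - q%:R) ^+ d * V <= f k <= (k%:R + q%:R) ^+ d * V) ->
  a d = d`!%:R * V.
Proof.
move=> fa fV.
have L := cvg_leading fa.
have hn n : n.+1%:R * h n = 1 by rewrite /harmonic /= mulfV ?pnatr_eq0.
have E (c : R) n : (n.+1%:R + c) ^+ d * V * h n ^+ d = (1 + c * h n) ^+ d * V.
  rewrite mulrAC -exprMn; congr (_ ^+ _ * _).
  by rewrite mulrDl hn.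
have U (c : R) : (fun n => (1 + c * h n) ^+ d * V) @ \oo --> V.
  rewrite -[X in _ --> X]mul1r; apply: cvgM; [exact: cvg_pow_perturb|exact: cvg_cst].
have h0 n : 0 <= h n ^+ d by rewrite exprn_ge0 // /harmonic /= invr_ge0.
suff : a d / d`!%:R = V.
  by move=> <-; rewrite mulrC divfK // pnatr_eq0 -lt0n fact_gt0.
apply/le_anti/andP; split.
  apply: (ler_cvg_to L (U q%:R)); exists q => // n /= qn.
  by rewrite -E ler_wpM2r //; have /andP[] := fV n.+1 qn.
apply: (ler_cvg_to (U (- q%:R)) L); exists q => // n /= qn.
by rewrite -E ler_wpM2r //; have /andP[] := fV n.+1 qn.
Qed.

End Leading.

(** * Squeezing a volume between grid counts *)

Section Sandwich.
Variables (R : realType) (d : nat).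

(* With e = q / (j + q), the cubes of side 1 / (j + q) at the points
   (1 - e) *: y + e *: p, for y in S0 on the shifted grid (1 / j) Z^d - c, lie in
   S; with e = q / j, rounding (1 - e) *: y + e *: p down to that grid stays in
   S0, so cubes of side 1 / (j - q) cover S. *)
Lemma lvol_sandwich (S S0 : set 'rV[R]_d) (p c : 'rV[R]_d) (q : nat) :
  (0 < q)%N -> S0 `<=` S -> bounded S0 ->
  (forall (y u : 'rV[R]_d) (e : R), S y -> (forall i, `|u ord0 i| <= q%:R^-1) -> 0 < e <= 1 ->
     S0 ((1 - e) *: y + e *: (p + u))) ->
  lvol S \is a fin_num /\
  forall j, (q < j)%N ->
    (j%:R - q%:R) ^+ d * fine (lvol S) <=
      icount R [set m | S0 (j%:R^-1 *: rz R m - c)] <=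
    (j%:R + q%:R) ^+ d * fine (lvol S).
Proof.
move=> q0 S0S bS0 HS.
have qR : 0 < q%:R :> R by rewrite ltr0n.
pose M j := [set m | S0 (j%:R^-1 *: rz R m - c)].
have fM j : (0 < j)%N -> finite_set (M j).
  move=> j0; have [B BP] := bS0.
  have := @finite_scaled R d [set x | S0 (x - c)] j j0; apply.
  exists (B + \sum_i `|c ord0 i|) => x /= Sx i.
  have := BP _ Sx i; rewrite !mxE => H.
  rewrite -[x ord0 i](subrK (c ord0 i)); apply: le_trans (ler_normD _ _) _.
  by apply: lerD => //; rewrite (bigD1 i) //= lerDl sumr_ge0.
have rex j : exists r : seq 'rV[int]_d, (0 < j)%N -> uniq r /\ M j = [set` r].
  have [->|j0] := posnP j; first by exists [::].
  exists (finmap.enum_fset (fset_set (M j))) => _; split; first exact: finmap.fset_uniq.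
  by rewrite -[LHS](fset_setK (fM j j0)).
have [r rP] := choice rex.
have cM j : (0 < j)%N -> icount R (M j) = (size (r j))%:R.
  by move=> /rP[u ->]; rewrite icount_seq.
have gridE j k (a : 'rV[R]_d) : (0 < j)%N -> (0 < k)%N ->
    lvol [set y | M j (cellof a (k%:R^-1) y)] = (icount R (M j) * k%:R ^- d)%:E.
  move=> j0 k0; have [u ME] := rP j j0.
  rewrite cM // -exprVn -(lvol_grid a _ u) ?invr_gt0 ?ltr0n //.
  by congr lvol; apply/seteqP; split => y /=; rewrite ME.
have floor_cell (k : nat) (a y : 'rV[R]_d) i : (0 < k)%N ->
    0 <= y ord0 i - a ord0 i - k%:R^-1 * (cellof a (k%:R^-1) y ord0 i)%:~R
      <= k%:R^-1.
  move=> k0; have kR : 0 < k%:R :> R by rewrite ltr0n.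
  have /andP[H1 H2] := floor_itv ((y ord0 i - a ord0 i) / k%:R^-1).
  move: H1 H2; rewrite mxE; move: (Num.floor _) => z.
  rewrite invrK intrD => H1 H2.
  apply/andP; split.
    rewrite subr_ge0 -(ler_pM2r kR); apply: le_trans H1.
    by rewrite mulrAC mulVf ?mul1r // gt_eqF.
  rewrite -(ler_pM2r kR) mulVf ?gt_eqF // mulrBl mulrAC mulVf ?gt_eqF // mul1r.
  by rewrite lerBlDl; apply: ltW.
have upper j : (0 < j)%N ->
    ((icount R (M j) * (j + q)%:R ^- d)%:E <= lvol S)%E.
  move=> j0; have k0 : (0 < j + q)%N by rewrite addn_gt0 j0.
  have kR : 0 < (j + q)%:R :> R by rewrite ltr0n.
  have jR : 0 < j%:R :> R by rewrite ltr0n.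
  pose e : R := q%:R / (j + q)%:R.
  (* The origin of the new grid comes from applying y -> (1 - e) y + e p to the point m / j - c,
     with 1 - e = j / (j + q). *)
  rewrite -(gridE _ _ (e *: p - (j%:R / (j + q)%:R) *: c) j0 k0).
  apply: le_lvol => y /=; set a := e *: p - _; set m := cellof _ _ _ => Mm.
  pose u : 'rV[R]_d := (e^-1) *: (y - a - (j + q)%:R^-1 *: rz R m).
  have e0 : 0 < e by rewrite divr_gt0.
  have e1 : e <= 1 by rewrite ler_pdivrMr // mul1r ler_nat leq_addl.
  have -> : y = (1 - e) *: (j%:R^-1 *: rz R m - c) + e *: (p + u).
    have eE : 1 - e = j%:R / (j + q)%:R.
      by rewrite /e natrD; field; rewrite -natrD gt_eqF.
    apply/rowP => i; rewrite /u /a eE !mxE; move: e0; rewrite /e natrD => e0; field.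
    by rewrite -natrD !gt_eqF.
  apply/S0S/HS; last by rewrite e0.
    exact: S0S.
  move=> i; rewrite /u mxE normrM.
  have := floor_cell (j + q)%N a y i k0; rewrite -/m => /andP[H1 H2].
  have -> : (y - a - (j + q)%:R^-1 *: rz R m) ord0 i =
      y ord0 i - a ord0 i - (j + q)%:R^-1 * (m ord0 i)%:~R by rewrite !mxE.
  rewrite (ger0_norm H1) gtr0_norm ?invr_gt0 //.
  apply: le_trans (ler_wpM2l _ H2) _; first by rewrite invr_ge0 ltW.
  by rewrite /e invf_div mulrAC mulfV ?gt_eqF // mul1r.
have lower j : (q < j)%N ->
    (lvol S <= (icount R (M j) * (j - q)%:R ^- d)%:E)%E.
  move=> qj; have k0 : (0 < j - q)%N by rewrite subn_gt0.
  have j0 : (0 < j)%N by exact: leq_ltn_trans qj.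
  have kR : 0 < (j - q)%:R :> R by rewrite ltr0n.
  have jR : 0 < j%:R :> R by rewrite ltr0n.
  pose e : R := q%:R / j%:R.
  have jq : (j - q)%:R = j%:R - q%:R :> R by rewrite natrB // ltnW.
  (* Here the origin is found by solving m / j - c = (1 - e) y + e p for y, with 1 - e = (j - q) /
     j. *)
  rewrite -(gridE _ _ (- ((j - q)%:R^-1) *: (q%:R *: p + j%:R *: c)) j0 k0).
  apply: le_lvol => y Sy; set a := - _ *: _ => /=.
  set m := cellof _ _ _; rewrite /M /=.
  pose u : 'rV[R]_d := - ((j - q)%:R / q%:R) *: (y - a - (j - q)%:R^-1 *: rz R m).
  have e0 : 0 < e by rewrite divr_gt0.
  have e1 : e <= 1 by rewrite ler_pdivrMr // mul1r ler_nat ltnW.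
  have -> : j%:R^-1 *: rz R m - c = (1 - e) *: y + e *: (p + u).
    apply/rowP => i; rewrite /u /a /e jq !mxE; field.
    by rewrite -jq !gt_eqF.
  apply: HS => //; last by rewrite e0.
  move=> i; rewrite /u mxE normrM.
  have := floor_cell (j - q)%N a y i k0; rewrite -/m => /andP[H1 H2].
  have -> : (y - a - (j - q)%:R^-1 *: rz R m) ord0 i =
      y ord0 i - a ord0 i - (j - q)%:R^-1 * (m ord0 i)%:~R by rewrite !mxE.
  rewrite (ger0_norm H1) normrN gtr0_norm ?divr_gt0 //.
  apply: le_trans (ler_wpM2l _ H2) _; first by rewrite divr_ge0 // ltW.
  by rewrite mulrAC mulfV ?gt_eqF // mul1r.
have fS : lvol S \is a fin_num.
  rewrite ge0_fin_numE ?lvol_ge0 //; apply: le_lt_trans (lower q.+1 (ltnSn q)) _.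
  by rewrite ltry.
split => // j qj; have j0 : (0 < j)%N by exact: leq_ltn_trans qj.
have k0 : 0 < (j + q)%:R :> R by rewrite ltr0n addn_gt0 j0.
have k0' : 0 < (j - q)%:R :> R by rewrite ltr0n subn_gt0.
have := lower j qj; have := upper j j0.
rewrite -(fineK fS) !lee_fin /= ler_pdivrMr ?exprn_gt0 // ler_pdivlMr ?exprn_gt0 //.
by rewrite natrD natrB ?(ltnW qj) // ![_ * fine _]mulrC => -> ->.
Qed.

End Sandwich.

(** * Lattice bases and normalized volume *)

Section LatticeBasis.
Variable R : realType.

Definition rmx m n (A : 'M[int]_(m, n)) : 'M[R]_(m, n) := map_mx intr A.

Lemma rmxM m n p (A : 'M[int]_(m, n)) (B : 'M[int]_(n, p)) :
  rmx (A *m B) = rmx A *m rmx B.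
Proof. exact: map_mxM. Qed.

Lemma rmx1 n : rmx (1%:M : 'M[int]_n) = 1%:M.
Proof. exact: map_mx1. Qed.

Lemma rmx_unit n (A : 'M[int]_n) : A \in unitmx -> rmx A \in unitmx.
Proof.
move=> uA; have H : rmx A *m rmx (invmx A) = 1%:M by rewrite -rmxM mulmxV // rmx1.
by case: (mulmx1_unit H).
Qed.

(* The rows of the right unimodular factor of a Smith normal form that face
   nonzero diagonal entries form a basis of the saturated lattice. *)
Lemma saturated_lattice_basis N n (M : 'M[int]_(N, n)) :
  exists r (B : 'M[int]_(r, n)),
    [/\ \rank (rmx B) = r, (rmx B :=: rmx M)%MS &
      forall z : 'rV[int]_n, (rmx z <= rmx M)%MS -> exists c, z = c *m B].
Proof.
have [L uL [T uT [d _ ME]]] := int_Smith_normal_form M.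
set D := \matrix_(i, j) _ in ME.
pose J : {set 'I_n} := finset (fun j : 'I_n => (j < N)%N && (d`_j != 0)).
pose P : 'M[int]_(#|J|, n) := \matrix_(i, j) (j == enum_val i)%:R.
pose B := P *m T.
have uL' := rmx_unit uL; have uT' := rmx_unit uT.
have DJ k (x : 'M[R]_(k, N)) i j : j \notin J -> (x *m rmx D) i j = 0.
  rewrite inE negb_and -leqNgt negbK => jJ; rewrite mxE big1 // => l _.
  rewrite !mxE; have [lj|_] := eqVneq (l : nat) j; last by rewrite mulr0n mulr0.
  case/orP: jJ => [Nj|/eqP dj]; first by have := ltn_ord l; rewrite lj ltnNge Nj.
  by rewrite lj dj mul0rn mulr0.
have MR : rmx M = rmx L *m rmx D *m rmx T by rewrite ME !rmxM.
have supJ (F : comNzRingType) k (y : 'M[F]_(k, n)) : (forall i j, j \notin J -> y i j = 0) ->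
    y = (\matrix_(i, j) y i (enum_val j)) *m (\matrix_(i < #|J|, j < n) (j == enum_val i)%:R).
  move=> yJ; apply/matrixP => i j; rewrite mxE.
  have [jJ|jJ] := boolP (j \in J); last first.
    rewrite yJ // big1 // => l _; rewrite !mxE.
    case: eqP => [jl|_]; last by rewrite mulr0.
    by rewrite jl enum_valP in jJ.
  rewrite (bigD1 (enum_rank_in jJ j)) //= !mxE enum_rankK_in // eqxx mulr1.
  rewrite big1 ?addr0 // => l lj; rewrite !mxE.
  case: eqP => [jl|_]; last by rewrite mulr0.
  by case/eqP: lj; apply: enum_val_inj; rewrite -jl enum_rankK_in.
have PE : rmx P = \matrix_(i < #|J|, j < n) (j == enum_val i)%:R.
  by apply/matrixP => i j; rewrite !mxE; case: eqP.
have BR : rmx B = rmx P *m rmx T by rewrite rmxM.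
have PP : rmx P *m (rmx P)^T = 1%:M.
  apply/matrixP => i j; rewrite mxE PE (bigD1 (enum_val i)) //= !mxE eqxx mul1r.
  rewrite big1 ?addr0 => [|l li]; first by rewrite (inj_eq enum_val_inj).
  by rewrite !mxE (negPf li) mul0r.
have rP : row_free (rmx P) by apply/row_freeP; exists (rmx P)^T.
have rB : \rank (rmx B) = #|J|.
  by rewrite BR mxrankMfree ?row_free_unit //; apply/eqP.
exists #|J|, B; split => //.
  apply/eqmxP/andP; split.
    apply/row_subP => i; rewrite BR row_mul.
    have jJ : enum_val i \in J := enum_valP i.
    have := jJ; rewrite inE => /andP[jN dj].
    have -> : row i (rmx P) = ((d`_(enum_val i))%:~R)^-1 *: row (Ordinal jN) (rmx D).
      apply/rowP => j; rewrite !mxE.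
      have [->|ji] := eqVneq j (enum_val i).
        by rewrite eqxx mulr1n mulVf // intr_eq0.
      have -> : (enum_val i == j :> nat) = false by rewrite eq_sym; apply/negbTE.
      by rewrite mulr0n mulr0.
    rewrite -scalemxAl scalemx_sub // -row_mul; apply: submx_trans (row_sub _ _) _.
    have -> : rmx D *m rmx T = invmx (rmx L) *m rmx M.
      by rewrite MR !mulmxA mulVmx // mul1mx.
    exact: submxMl.
  rewrite MR (supJ _ _ (rmx L *m rmx D)); last by move=> i j /DJ ->.
  by rewrite -PE -mulmxA -BR submxMl.
(* Integrality comes from T being unimodular: z = y T with y integral. The relation over the reals
   serves to show that the columns of y outside J vanish. *)
move=> z /submxP[x zE].
have [y yE] : exists y, z = y *m T by exists (z *m invmx T); rewrite mulmxKV.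
have yJ i j : j \notin J -> y i j = 0.
  move=> jJ; have : rmx y = x *m rmx L *m rmx D.
    apply: (can_inj (mulmxK uT')); rewrite -rmxM -yE zE MR !mulmxA //.
  move/matrixP/(_ i j); rewrite DJ // mxE => /eqP.
  by rewrite intr_eq0 => /eqP.
exists (\matrix_(i, j) y i (enum_val j)).
by rewrite yE mulmxA -supJ.
Qed.

(** Openness is given along lines, so the cube is built one coordinate at a time. A displacement is
    the midpoint of twice its part along the new axis and twice the remaining part, which explains
    the halved radius. *)
Lemma open_cvx_cube d (C : set 'rV[R]_d) x : cvx C ->
  (forall y v, C y -> exists2 e : R, 0 < e & C (y + e *: v)) -> C x ->
  exists2 r : R, 0 < r & forall u : 'rV[R]_d, (forall i, `|u ord0 i| <= r) -> C (x + u).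
Proof.
move=> cC oC Cx.
suff H k : (k <= d)%N -> exists2 r : R, 0 < r & forall u : 'rV[R]_d,
    (forall i, `|u ord0 i| <= r) -> (forall i : 'I_d, (k <= i)%N -> u ord0 i = 0) -> C (x + u).
  have [r r0 Hr] := H d (leqnn d); exists r => // u ur; apply: Hr => // i.
  by rewrite leqNgt ltn_ord.
elim: k => [_|k IHk kd].
  exists 1 => // u _ u0; rewrite (_ : u = 0) ?addr0 //.
  by apply/rowP => i; rewrite u0 // mxE.
have [r r0 Hr] := IHk (ltnW kd).
pose i0 := Ordinal kd; pose v : 'rV[R]_d := delta_mx ord0 i0.
have [e e0 Ce] := oC x v Cx; have [f f0 Cf] := oC x (- v) Cx.
pose g := Num.min r (Num.min e f).
have g0 : 0 < g by rewrite !lt_min r0 e0 f0.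
have gr : g <= r by rewrite ge_min lexx.
have ge_ : g <= e by rewrite !ge_min lexx orbT.
have gf : g <= f by rewrite !ge_min lexx !orbT.
exists (g / 2); first by rewrite divr_gt0.
move=> u ug u0.
pose u' : 'rV[R]_d := \row_i if i == i0 then 0 else 2 * u ord0 i.
have H1 : C (x + u').
  apply: Hr => i; rewrite mxE; case: eqP => // ii0.
  - by rewrite normr0 ltW.
  - by rewrite normrM gtr0_norm //; have := ug i; lra.
  - move=> ki; rewrite u0 ?mulr0 // ltn_neqAle ki andbT; apply/eqP => kE.
    by apply: ii0; apply/val_inj.
have H2 : C (x + (2 * u ord0 i0) *: v).
  have := ug i0; rewrite ler_norml => /andP[ug1 ug2].
  have [->|un0] := eqVneq (u ord0 i0) 0; first by rewrite mulr0 scale0r addr0.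
  have [up|un] := ltP 0 (u ord0 i0).
    by apply: cvx_shrink cC Cx Ce _; lra.
  have un' : u ord0 i0 < 0 by rewrite lt_neqAle un0.
  rewrite -[_ *: v]opprK -scaleNr -scalerN.
  by apply: cvx_shrink cC Cx Cf _; lra.
have half : 0 <= (2^-1 : R) <= 1 by lra.
have := cC _ _ _ H1 H2 half; congr C.
apply/rowP => i; rewrite !mxE /=; case: eqP => [->|_].
  by rewrite mulr1n; field.
by rewrite mulr0n; field.
Qed.

End LatticeBasis.

(** * The leading coefficient of a facet as its normalized volume *)

Section FacetVolume.
Variables (R : realType) (n : nat).
Local Notation V := 'rV[R]_n.

Lemma hull_sub_diffs N (s : 'I_N -> V) i0 x y : hull s x -> hull s y ->
  (x - y <= \matrix_i (s i - s i0))%MS.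
Proof.
move=> [w [w0 [w1 ->]]] [v [v0 [v1 ->]]].
have -> : \sum_i w i *: s i - \sum_i v i *: s i =
    (\row_i (w i - v i)) *m \matrix_i (s i - s i0).
  rewrite mulmx_sum_row.
  under [RHS]eq_bigr do rewrite rowK mxE scalerBr.
  rewrite sumrB -scaler_suml sumrB w1 v1 subrr scale0r subr0 -sumrB.
  by apply: eq_bigr => i _; rewrite scalerBl.
exact: submxMl.
Qed.

Lemma parallel_hullP N (s : 'I_N -> V) i0 v :
  parallel_space (hull s) v <-> (v <= \matrix_i (s i - s i0))%MS.
Proof.
split=> [[m [c [x [y [xy ->]]]]]|/submxP[c ->]].
  apply: summx_sub => i _; apply: scalemx_sub.
  by have [] := xy i; exact: hull_sub_diffs.
exists N, (c 0), s, (fun=> s i0); split.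
  by move=> i; split; exact: hull_in.
by rewrite mulmx_sum_row; apply: eq_bigr => i _; rewrite rowK.
Qed.

Lemma rank_hull_diffs N (s : 'I_N -> V) i0 :
  \rank (\matrix_i (s i - s i0)) = dimc (hull s).
Proof.
have s0 := hull_in s i0.
have [p [pP rp]] := dimc_affind s0.
have U0 := affind_span pP rp.
apply: etrans rp; apply: eqmx_rank; apply/andP; split.
  by apply/row_subP => i; rewrite rowK; apply: U0 => //; exact: hull_in.
by apply/row_subP => i; rewrite rowK; exact: hull_sub_diffs.
Qed.

Lemma rz_rmx (z : 'rV[int]_n) : rz R z = rmx R z.
Proof. by apply/rowP => i; rewrite !mxE. Qed.

Lemma rzMn (z : 'rV[int]_n) k : rz R (z *+ k) = k%:R *: rz R z.
Proof.
elim: k => [|k IHk]; first by rewrite mulr0n scale0r; apply/rowP => i; rewrite !mxE.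
by rewrite mulrS rzD IHk -[k.+1%:R]/(1 *+ k.+1) mulrS scalerDl scale1r.
Qed.

(** [normvol] measures from an arbitrary base point [x0] of the facet, in general not a lattice
    point. In its coordinates the lattice points of the k-th dilate, divided by k, form a grid of
    mesh 1 / k shifted by a vector [c] independent of k; this is the form in which [lvol_sandwich]
    counts. *)
Lemma normvol_leading N (s : 'I_N -> V) (p a : nat -> R) :
  (0 < N)%N -> (forall i, Defs.integral (s i)) -> dimc (hull s) = n.-1 ->
  (forall k, p k = \sum_(i < n.-1.+1) a i * 'C(k, i)%:R) ->
  (forall k, (0 < k)%N ->
     p k = icount R [set z | relint (hull s) (k%:R^-1 *: rz R z)]) ->
  a n.-1 = (n.-1)`!%:R * normvol (hull s).
Proof.
move=> N0 si dF pa pk.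
pose i0 := Ordinal N0.
have [t tE] := choice (fun i => integral_rz (si i)).
pose F := hull s.
pose M := \matrix_i (s i - s i0).
pose MZ : 'M[int]_(N, n) := \matrix_i (t i - t i0).
have ME : M = rmx R MZ.
  by apply/matrixP => i j; rewrite !mxE !tE !mxE intrB.
have rM : \rank M = n.-1 by rewrite rank_hull_diffs.
pose B := xget (0 : 'M[R]_(n.-1, n)) [set B | lattice_basis (parallel_space F) B].
pose x0 := xget (0 : V) F.
have -> : normvol (hull s) = fine (lvol [set y | F (x0 + y *m B)]) by [].
have cF : cvx F by exact: hull_cvx.
have Fx0 : F x0 by apply: xgetPex; exists (s i0); exact: hull_in.
have [iB LB rB gB] : lattice_basis (parallel_space F) B.
  (* The Smith normal form supplies a basis, so the default value of [xget] does not occur. *)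
  apply: xgetPex; have [r [B0 [rB0 B0M B0g]]] := saturated_lattice_basis R MZ.
  have r_n : r = n.-1 by rewrite -rB0 B0M -ME rM.
  subst r; exists (rmx R B0); split => //.
  - by move=> i j; rewrite !mxE; apply/intrP; exists (B0 i j).
  - move=> i; apply/(parallel_hullP s i0); rewrite -/M ME -B0M; exact: row_sub.
  - move=> v /(parallel_hullP s i0); rewrite -/M ME => vM /integral_rz[z vz].
    rewrite vz rz_rmx in vM *; have [c ->] := B0g z vM.
    by exists c; rewrite rmxM.
have [BZ BE] : exists BZ : 'M[int]_(n.-1, n), B = rmx R BZ.
  have [f fE] := choice (fun i => integral_rz (iB i)).
  exists (\matrix_i f i); apply/row_matrixP => i; rewrite fE.
  by apply/rowP => j; rewrite !mxE.
have BM : (B <= M)%MS.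
  by apply/row_subP => i; apply/(parallel_hullP s i0); exact: LB.
have MB : (M <= B)%MS.
  by have := mxrank_leqif_sup BM; rewrite rM rB => -[_ <-].
have fB : row_free B by apply/eqP.
have [B' BB'] := row_freeP fB.
have coord x y : F x -> F y -> exists u, y = x + u *m B.
  move=> Fx Fy; have /submxP[u uE] : (y - x <= B)%MS.
    by apply: submx_trans MB; exact: hull_sub_diffs.
  by exists u; rewrite -uE addrC subrK.
pose S : set 'rV[R]_n.-1 := [set y | F (x0 + y *m B)].
pose S0 : set 'rV[R]_n.-1 := [set y | relint F (x0 + y *m B)].
rewrite -/S.
have S0S : S0 `<=` S by move=> y; exact: relint_sub.
have convE (y z : 'rV[R]_n.-1) (e : R) : x0 + ((1 - e) *: y + e *: z) *m B =
    (1 - e) *: (x0 + y *m B) + e *: (x0 + z *m B).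
  rewrite mulmxDl -!scalemxAl !scalerDr addrACA -scalerDl subrK scale1r.
  by [].
have bS0 : bounded S0.
  apply: sub_bounded S0S _; have [C FC] := hull_bounded s.
  exists (\sum_j \sum_i (C + C) * `|B' j i|) => y Sy i.
  have -> : y = (x0 + y *m B - x0) *m B'.
    by rewrite addrAC subrr add0r -mulmxA BB' mulmx1.
  rewrite mxE; apply: le_trans (ler_norm_sum _ _ _) _; apply: ler_sum => j _.
  have H : `|(x0 + y *m B - x0) ord0 j| <= C + C.
    rewrite [X in `|X|]mxE [X in _ + X]mxE; apply: le_trans (ler_normB _ _) _.
    by apply: lerD; apply: FC.
  have C0 : 0 <= C + C by exact: le_trans H.
  rewrite normrM; apply: le_trans (_ : (C + C) * `|B' j i| <= _).
    by rewrite ler_wpM2r.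
  by rewrite (bigD1 i) //= lerDl sumr_ge0 // => l _; rewrite mulr_ge0.
have rx := relint_hull_nonempty s N0; set xs := _ *: _ in rx.
have [pt ptE] := coord _ _ Fx0 (relint_sub rx).
have [q q0 Hq] : exists2 q, (0 < q)%N & forall u : 'rV[R]_n.-1,
    (forall i, `|u ord0 i| <= q%:R^-1) -> S0 (pt + u).
  have cS0 : cvx S0.
    by move=> y z e Sy Sz e01; rewrite /S0 /= convE; apply: relint_cvx.
  have oS0 y v : S0 y -> exists2 e : R, 0 < e & S0 (y + e *: v).
    move=> Sy; have [U [_ FU [_ _ oU]]] := relint_roc cF Fx0.
    have vU : (v *m B <= U)%MS.
      apply: submx_trans (submxMl _ _) _; apply: submx_trans BM _.
      by apply/row_subP => i; rewrite rowK; apply: FU; exact: hull_in.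
    have [e e0 He] := oU _ _ Sy vU; exists e => //.
    by move: He; rewrite /S0 /= mulmxDl -scalemxAl addrA.
  have Spt : S0 pt by rewrite /S0 /= -ptE.
  have [r r0 Hr] := open_cvx_cube cS0 oS0 Spt.
  exists (Num.truncn r^-1).+1 => // u ur; apply: Hr => i.
  apply: le_trans (ur i) _; rewrite -[leRHS]invrK lef_pV2 ?posrE ?invr_gt0 ?ltr0n //.
  by apply: ltW; apply: truncnS_gt.
have [c cE] := coord _ _ (hull_in s i0) Fx0.
have HS (y u : 'rV[R]_n.-1) (e : R) : S y -> (forall i, `|u ord0 i| <= q%:R^-1) ->
    0 < e <= 1 -> S0 ((1 - e) *: y + e *: (pt + u)).
  by move=> Sy /Hq Su e01; rewrite /S0 /= convE; exact: relint_mid.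
have [_ sand] := lvol_sandwich c q0 S0S bS0 HS.
apply: (leading_coef_sandwich (q := q) pa) => k qk.
have k0 : (0 < k)%N by exact: leq_ltn_trans qk.
have kn0 : (k%:R : R) != 0 by rewrite pnatr_eq0 -lt0n.
rewrite pk //.
suff -> : icount R [set z | relint (hull s) (k%:R^-1 *: rz R z)] =
    icount R [set m | S0 (k%:R^-1 *: rz R m - c)] by exact: sand.
apply/esym.
(* Parametrizes the lattice points of the affine hull of k F, starting from k times an integral
   generator; [gB], the lattice basis property, gives surjectivity. *)
pose phi (m : 'rV[int]_n.-1) : 'rV[int]_n := t i0 *+ k + m *m BZ.
have phiE m : rz R (phi m) = k%:R *: s i0 + rz R m *m B.
  rewrite /phi rzD tE BE; congr (_ + _).
    exact: rzMn.
  by rewrite !rz_rmx rmxM.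
have phiV m : k%:R^-1 *: rz R (phi m) = x0 + (k%:R^-1 *: rz R m - c) *m B.
  rewrite phiE scalerDr scalerA mulVf // scale1r mulmxBl -scalemxAl.
  by rewrite {1}cE [_ - c *m B]addrC addrA addrK.
rewrite -(@icount_image R _ _ phi); last first.
  move=> u v /(congr1 (@rz R n)); rewrite !phiE => /addrI.
  by move=> /(row_free_inj fB)/rz_inj.
congr icount; apply/seteqP; split => z /=.
  by move=> [m Sm <-]; move: Sm; rewrite phiV.
move=> Fz; have Fz' := relint_sub Fz.
have : parallel_space F (rz R (z - t i0 *+ k)).
  exists 1%N, (fun=> k%:R), (fun=> k%:R^-1 *: rz R z), (fun=> s i0); split.
    by move=> _; split => //; exact: hull_in.
  rewrite big_ord1 scalerBr scalerA mulfV // scale1r rzB; congr (_ - _).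
  by rewrite tE rzMn.
move=> /gB /(_ (rz_integral _ _))[m mE].
have zE : z = phi m.
  apply: (@rz_inj R n); rewrite /phi rzD -[LHS](subrK (rz R (t i0 *+ k))) addrC -rzB.
  by rewrite mE rz_rmx [in RHS]rz_rmx rmxM BE.
exists m; last by rewrite -zE.
by move: Fz; rewrite zE phiV.
Qed.

End FacetVolume.

(** * Boundary complexes *)

Section Complexes.
Variables (R : realType) (n : nat).
Local Notation V := 'rV[R]_n.

(** The face then contains an affinely spanning family of P, on which the functional is constant, so
    it is constant on P. *)
Lemma face_dim_eq (G P : set V) : face G P -> dimc G = dimc P -> G = P.
Proof.
move=> [[x Gx] [a [b [ab GE]]]] dGP.
have [p [pG rp]] : affind G (dimc P) by rewrite -dGP; exact: dimc_affind Gx.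
have pP i : P (p i) by have := pG i; rewrite GE => -[].
have pb i : dotv a (p i) = b by have := pG i; rewrite GE => -[].
have U0 := affind_span pP rp.
rewrite GE; apply/seteqP; split => y; first by case.
move=> Py; split => //=; have /submxP[c cE] := U0 _ _ Py (pP ord0).
apply/eqP; rewrite -(pb ord0) -subr_eq0 -dotvBr cE mulmx_sum_row dotv_sumr.
rewrite big1 // => i _; rewrite rowK dotvZr dotvBr !pb subrr mulr0 //.
Qed.

Lemma dimc_set1 (x : V) : dimc [set x] = 0%N.
Proof.
have [p [px rp]] := dimc_affind (erefl x : [set x] x).
rewrite -rp; apply/eqP; rewrite mxrank_eq0; apply/eqP/row_matrixP => i.
by rewrite rowK row0 (px (lift ord0 i)) (px ord0) subrr.
Qed.

Lemma face_refl (P : set V) : P !=set0 -> face P P.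
Proof.
move=> P0; split => //; exists 0, 0; split; first by move=> x _; rewrite dotv0l.
by apply/seteqP; split => [x Px|x []] //; split => //=; rewrite dotv0l.
Qed.

(** Integrality is assumed for cells of dimension 0 only. A point exposed as a face is such a cell,
    by closure under faces, so [hull_vertices] yields integral generators. *)
Lemma cell_hull (C : set (set V)) (P : set V) : lattice_complex C -> C P ->
  exists N (s : 'I_N -> V), [/\ (0 < N)%N, P = hull s & forall i, Defs.integral (s i)].
Proof.
move=> [[_ polC faceC _] verC] CP.
have [S [S0 PE]] := polC P CP.
have PS : P = hull (fun i : 'I_(size S) => S`_i) by [].
have [|N [s [hE si]]] := @hull_vertices _ _ _ (fun i : 'I_(size S) => S`_i)
    (@Defs.integral R n).
  move=> x; rewrite -PS => /(faceC _ _ CP) Cx.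
  by apply: (verC _ Cx) => //; exact: dimc_set1.
exists N, s; split => //; last by rewrite PS.
have S0' : (0 < size S)%N by rewrite lt0n size_eq0.
have := hull_in (fun i : 'I_(size S) => S`_i) (Ordinal S0').
rewrite hE; case: N {hE si} s => // s [w [_ []]].
by rewrite big_ord0 => /esym/eqP; rewrite oner_eq0.
Qed.

(** Coefficients of cells of lower dimension are padded with zeros up to index n - 1, so all cells
    can be compared at that index, where only those of dimension n - 1 contribute. *)
Lemma cell_ehrhart (C : set (set V)) (P : set V) : (0 < n)%N ->
  lattice_complex C -> C P -> (dimc P <= n.-1)%N ->
  exists p a : nat -> R,
    [/\ forall k, p k = \sum_(i < n.-1.+1) a i * 'C(k, i)%:R,
        forall k, (0 < k)%N -> p k = icount R [set z | relint P (k%:R^-1 *: rz R z)],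
        p 0 = (-1) ^+ dimc P &
        a n.-1 = if dimc P == n.-1 then (n.-1)`!%:R * normvol P else 0].
Proof.
move=> n0 lC CP; have [N [s [N0 -> si]]] := cell_hull lC CP => dP.
have [p [[a pa] pk p0]] := relint_ehrhart N0 si.
case: eqVneq => [dPn|dPn].
  exists p, a; rewrite dPn in pa; split => //.
  exact: normvol_leading pk.
exists p, (fun i => if (i < (dimc (hull s)).+1)%N then a i else 0); split => //.
  move=> k; rewrite pa (big_ord_widen n.-1.+1 (fun i => a i * 'C(k, i)%:R)) //.
  by rewrite big_mkcond /=; apply: eq_bigr => i _; case: ifP => // _; rewrite mul0r.
by rewrite ltnS leqNgt ltn_neqAle dPn dP.
Qed.

Lemma boundary_cell (C : set (set V)) (G : set V) : polyhedral_complex C ->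
  boundary C G -> C G /\ (dimc G <= n.-1)%N.
Proof.
move=> [_ _ faceC _] [F [[CF [dF _]] GF]]; split; first exact: faceC GF.
rewrite -dF; have [[x Gx] [a [b [_ GE]]]] := GF.
by apply: dimc_mono Gx _; rewrite GE => y [].
Qed.

Lemma facetsE (C : set (set V)) : polyhedral_complex C ->
  facets C = boundary C `&` [set G | dimc G = n.-1].
Proof.
move=> cC; apply/seteqP; split => [F FF|G [[F [FF GF]] /= dG]].
  have [CF [dF _]] := FF; split => //; exists F; split => //; apply: face_refl.
  have [_ polC _ _] := cC; have [S [S0 ->]] := polC F CF.
  have S0' : (0 < size S)%N by rewrite lt0n size_eq0.
  by exists S`_0; apply: (@hull_in _ _ _ (fun i : 'I_(size S) => S`_i) (Ordinal S0')).
have [CF [dF _]] := FF.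
by rewrite (face_dim_eq GF) // dG dF.
Qed.

(** The intersection is a face of both cells and meets both relative interiors, so by [relint_face]
    it equals each of them. *)
Lemma relint_cell_uniq (C : set (set V)) (G G' : set V) x : polyhedral_complex C ->
  C G -> C G' -> relint G x -> relint G' x -> G = G'.
Proof.
move=> [_ _ _ intC] CG CG' rx rx'.
have GG'x : (G `&` G') x by split; exact: relint_sub.
have [f1 f2] := intC G G' CG CG' (ex_intro _ x GG'x).
by rewrite -(relint_face f1 rx GG'x) -[RHS](relint_face f2 rx' GG'x).
Qed.

Lemma support_boundary (C : set (set V)) x : lattice_complex C ->
  Defs.support (boundary C) x <-> exists2 G, boundary C G & relint G x.
Proof.
move=> lC; split => [[G [[F [FF GF]] Gx]]|[G bG /relint_sub Gx]]; last by exists G.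
have Fx : F x by move: GF Gx => [_ [a [b [_ ->]]]] [].
have [CF _] := FF; have [N [s [_ FE _]]] := cell_hull lC CF.
rewrite FE in Fx; have [H [HF rH]] := hull_face_relint Fx.
by exists H => //; exists F; rewrite FE in FF *.
Qed.

End Complexes.

Theorem theorem4p7 (R : realType) (n : nat) (Q : set (set 'rV[R]_n)) :
  (0 < n)%N -> lattice_complex Q -> pure Q n ->
  \sum_(F \in facets Q) (n.-1)`!%:R * normvol F =
  (-1) ^+ n.-1 * \sum_(k < n) (-1) ^+ k * 'C(n.-1, k)%:R * Bcount k (boundary Q).
Proof.
move=> n0 lQ _; have cQ : polyhedral_complex Q by case: lQ.
have fB : finite_set (boundary Q).
  by have [fQ _ _ _] := cQ; apply: sub_finite_set fQ => G /(boundary_cell cQ)[].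
pose cs : seq (set 'rV[R]_n) := finmap.enum_fset (fset_set (boundary Q)).
have ucs : uniq cs by exact: finmap.fset_uniq.
have csE : boundary Q = [set` cs] by rewrite -[LHS](fset_setK fB).
have csP G : G \in cs -> boundary Q G by rewrite csE.
have H G : exists pa : (nat -> R) * (nat -> R), G \in cs ->
    [/\ forall k, pa.1 k = \sum_(i < n.-1.+1) pa.2 i * 'C(k, i)%:R,
        forall k, (0 < k)%N -> pa.1 k = icount R [set z | relint G (k%:R^-1 *: rz R z)],
        pa.1 0 = (-1) ^+ dimc G &
        pa.2 n.-1 = if dimc G == n.-1 then (n.-1)`!%:R * normvol G else 0].
  have [Gcs|_] := boolP (G \in cs); last by exists (fun=> 0, fun=> 0).
  have [QG dG] := boundary_cell cQ (csP G Gcs).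
  by have [p [a paP]] := cell_ehrhart n0 lQ QG dG; exists (p, a).
have [pa paP] := choice H.
have BE k : Bcount k (boundary Q) = \sum_(G <- cs) (pa G).1 k.
  rewrite /Bcount; case: posnP => [->|k0].
    (* At k = 0 the convention enters: the terms of the Euler characteristic are the constant terms
       of the cell polynomials. *)
    rewrite /euler_char csE -fsbig_seq //; apply: eq_big_seq => G Gcs.
    by have [_ _ ->] := paP G Gcs.
  have -> : \sum_(G <- cs) (pa G).1 k =
      \sum_(G <- cs) icount R [set z | relint G (k%:R^-1 *: rz R z)].
    by apply: eq_big_seq => G Gcs; have [_ pk _ _] := paP G Gcs; exact: pk.
  have [||| _ <-] := @icount_bigcup R _ _ cs (fun G => [set z | relint G (k%:R^-1 *: rz R z)]).
  - exact: ucs.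
  - move=> G Gcs; have [QG _] := boundary_cell cQ (csP G Gcs).
    have [N [s [_ GE _]]] := cell_hull lQ QG.
    apply: finite_scaled => //; apply: sub_bounded (hull_bounded s).
    by rewrite -GE; exact: relint_sub.
  - move=> G G' z /csP/(boundary_cell cQ)[QG _] /csP/(boundary_cell cQ)[QG' _].
    exact: relint_cell_uniq cQ QG QG'.
  congr icount; apply/seteqP; split => z /=.
    by move/(support_boundary _ lQ) => [G]; rewrite csE => Gcs rG; exists G.
  by move=> [G /csP bG rG]; apply/(support_boundary _ lQ); exists G.
have facE : facets Q = [set` [seq G <- cs | dimc G == n.-1]].
  rewrite (facetsE cQ) csE; apply/seteqP; split => G /=.
    by move=> [Gcs dG]; rewrite mem_filter Gcs dG eqxx.
  by rewrite mem_filter => /andP[/eqP dG Gcs].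
rewrite facE -fsbig_seq ?filter_uniq // big_filter big_mkcond /=.
under [in RHS]eq_bigr do rewrite BE mulr_sumr.
rewrite exchange_big /= mulr_sumr; apply: eq_big_seq => G Gcs.
have [pE _ _ pl] := paP G Gcs.
rewrite -pl; move: (altsum_pdeg pE); rewrite prednK // => ->.
by rewrite mulrA -exprMn mulrNN mulr1 expr1n mul1r.
Qed.
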